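(* Let $\Gamma$ be a polycyclic-by-finite group. Then either $\Gamma$ has polynomial growth or $\Gamma$ has uniform exponential growth.
   Context: A group is polycyclic-by-finite if it has a normal polycyclic subgroup of finite index. Growth: let $\Gamma$ be a finitely generated group and $S$ a finite generating set. The length of $g\in\Gamma$ is $\lambda_S(g)=\min\{n \mid g=s_1\cdots s_n,\ s_i\in S\cup S^{-1}\}$, and $\beta_n(S,\Gamma)=|\{g\in\Gamma \mid \lambda_S(g)\le n\}|$. The growth rate is $\beta(S,\Gamma)=\lim_{n\to\infty}\beta_n(S,\Gamma)^{1/n}$. $\Gamma$ has polynomial growth if for some (equivalently any) finite generating set $S$, $\beta_n(S,\Gamma)$ is bounded above by a polynomial in $n$. Put $\beta(\Gamma)=\inf_S\beta(S,\Gamma)$, the infimum over all finite generating sets $S$ of $\Gamma$. $\Gamma$ has uniform exponential growth if $\beta(\Gamma)>1$. *)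

(* Defs.v *)
From HB Require Import structures.
From mathcomp Require Import all_boot all_order all_algebra finmap.
From mathcomp Require Import boolp classical_sets functions cardinality reals.
From mathcomp Require Import topology normedtype sequences exp.

Set Implicit Arguments.
Unset Strict Implicit.
Unset Printing Implicit Defensive.

Import Order.TTheory GRing.Theory Num.Theory.
Import numFieldNormedType.Exports.

Local Open Scope classical_set_scope.
Local Open Scope group_scope.

Section Groups.
Context {G : groupType}.
Implicit Types (H K N S : set G) (g t x y : G).

Definition is_subgroup H : Prop := group_closed (mem H).

Definition normal_in H K : Prop :=
  [/\ is_subgroup H, is_subgroup K, H `<=` K &
      forall x y, H x -> K y -> H (x ^ y)].

(* monoid.v only has natural powers of group elements. *)
Definition expgz x (z : int) : G :=
  match z with Posz n => x ^+ n | Negz n => x ^- n.+1 end.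

Definition lcoset_set x H : set G := [set x * h | h in H].

(* For H normal in K: the group K / H is generated by the coset t H, i.e.
   every coset x H is a power (t H)^z = t^z H. *)
Definition cyclic_quotient K H : Prop :=
  exists2 t, K t &
    forall x, K x -> exists z : int, lcoset_set x H = lcoset_set (expgz t z) H.

Definition polycyclic K : Prop :=
  exists (k : nat) (H : nat -> set G),
    [/\ H 0%N = [set 1], H k = K &
        forall i, (i < k)%N ->
          normal_in (H i) (H i.+1) /\ cyclic_quotient (H i.+1) (H i)].

Definition finite_index H : Prop :=
  finite_set [set lcoset_set x H | x in [set: G]].

Definition finite_generating_set S : Prop :=
  finite_set S /\ smallest is_subgroup S = [set: G].

(* g = s_1 ... s_n with every s_i in S or S^-1 *)
Definition is_word S (n : nat) g : Prop :=
  exists w : seq G,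
    [/\ size w = n, forall s, s \in w -> S s \/ S s^-1
      & g = \prod_(s <- w) s].

(* The least n such that is_word S n g; the default 0 is only reached when g is
   not in the subgroup generated by S. *)
Definition word_length S g : nat :=
  xget 0%N [set n | is_word S n g /\ forall m, is_word S m g -> (n <= m)%N].

(* Balls are finite when S is a finite generating set, so that fset_set does not
   return its default value fset0. *)
Definition growth_function S (n : nat) : nat :=
  #|` fset_set [set g | (word_length S g <= n)%N] |.

End Groups.

Definition polycyclic_by_finite (G : groupType) : Prop :=
  exists N : set G,
    [/\ normal_in N [set: G], polycyclic N & finite_index N].

Section Growth.
Variable R : realType.
Local Open Scope ring_scope.

(* The limit exists for finite generating sets (the growth function is
   submultiplicative); the term at n = 0 is 1 and is irrelevant. *)
Definition growth_rate (G : groupType) (S : set G) : R :=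
  limn (fun n : nat => (growth_function S n)%:R `^ (n%:R)^-1 : R).

Definition polynomial_growth (G : groupType) : Prop :=
  exists (S : set G), finite_generating_set S /\
    exists p : {poly R},
      forall n : nat, (growth_function S n)%:R <= p.[n%:R].

(* The infimum of the empty set is 0 in the library, so only finitely generated
   groups can satisfy uniform_exponential_growth below. *)
Definition min_growth_rate (G : groupType) : R :=
  inf [set growth_rate S | S in [set S : set G | finite_generating_set S]].

Definition uniform_exponential_growth (G : groupType) : Prop :=
  1 < min_growth_rate G.

End Growth.

(* Main.v *)
(* Call a pair (t, a) free when the products t a^{e_1} ... t a^{e_k}, with e_i in
   {0, 1}, are pairwise distinct for every k.  If for some L every generating set
   S has a free pair of S-length at most L, the growth rates are bounded below by
   2^{1/(2L+1)}.  Otherwise, for every L some S has no free pair of length at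
   most L, and we show that the group is virtually nilpotent.

   Let N be polycyclic of finite index, with a normal series D_j having abelian
   factors, and suppose that H <= N has finite index and is nilpotent modulo
   E = D_j.  Modulo torsion E / D_{j+1} is Z^n, on which N acts by integer
   matrices.  Take t, a of bounded length with a in E.  If t had an eigenvalue l
   with |l| > 2 on Z^n and a did not vanish on the eigenvector, then (t, a) would
   be free, since polynomials with coefficients in {-1, 0, 1} have no root of
   modulus > 2.  Iterated commutators of elements of S, and their conjugates by
   short words, provide enough such a to exclude such an eigenvalue.  Hence the
   trace of t is at most 2n in modulus; if moreover t is congruent to 1 modulo an
   integer > 3n, the trace is n.  A group of matrices whose short words in the
   generators all have trace n is unipotent, so a finite index subgroup is
   nilpotent modulo D_{j+1}.

   Finally, in a nilpotent group h^{t^k} is a product of polynomially many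
   iterated commutators [h, t, ..., t], so polynomial growth climbs up the
   polycyclic series, and then to finite extensions. *)

From HB Require Import structures.
Require Import Defs.
From mathcomp Require Import all_boot all_order all_algebra all_field finmap.
From mathcomp Require Import boolp classical_sets functions cardinality reals.
From mathcomp Require Import topology normedtype sequences exp.
From mathcomp Require Import ring lra zify.

Set Implicit Arguments.
Unset Strict Implicit.
Unset Printing Implicit Defensive.

Import Order.TTheory GRing.Theory Num.Theory.
Import numFieldNormedType.Exports.

Local Open Scope ring_scope.

(** * Linear algebra *)

Lemma exists_spanning_seq (F : fieldType) (V : vectType F) (P : V -> Prop) :
  exists X : seq V,
    (forall x, x \in X -> P x) /\ (forall v, P v -> v \in <<X>>%VS).
Proof.
pose D d := `[< exists X : seq V, (forall x, x \in X -> P x) /\ \dim <<X>> = d >].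
have D0 : exists d, D d by exists 0%N; apply/asboolP; exists nil; rewrite span_nil dimv0.
have Dmax d : D d -> (d <= \dim {:V})%N.
  by move=> /asboolP[X [_ <-]]; rewrite dimvS// subvf.
case: (ex_maxnP D0 Dmax) => d /asboolP[X [PX dX]] dmax.
exists X; split=> // v Pv.
have /dmax : D (\dim <<v :: X>>).
  by apply/asboolP; exists (v :: X); split=> // x; rewrite inE => /predU1P[->|/PX].
rewrite -dX => le.
have sub : (<<X>> <= <<v :: X>>)%VS by apply: sub_span => x xX; rewrite inE xX orbT.
have /eqP -> : <<X>>%VS == <<v :: X>>%VS by rewrite eqEdim sub.
by rewrite memv_span// mem_head.
Qed.

Lemma span_ind (F : fieldType) (V : vectType F) (Q : V -> Prop) (X : seq V) :
  Q 0 -> (forall c u v, Q u -> Q v -> Q (c *: u + v)) ->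
  (forall x, x \in X -> Q x) -> forall v, v \in <<X>>%VS -> Q v.
Proof.
move=> Q0 QD; elim: X => [|x X IH] QX v.
  by rewrite span_nil memv0 => /eqP ->.
rewrite span_cons => /memv_addP[u /vlineP[c ->] [w wX ->]].
apply: QD; first by apply: QX; rewrite mem_head.
by apply: IH wX => y yX; apply: QX; rewrite inE yX orbT.
Qed.

(* The spans of the words of length at most k increase with k; by dimension they
   stall at some k <= n * n, and then contain all words. *)
Lemma span_words (F : fieldType) (n : nat) (P : 'M[F]_n -> Prop) :
  let word k x := exists w : seq 'M[F]_n,
    [/\ (size w <= k)%N, forall m, m \in w -> P m & x = \prod_(m <- w) m] in
  exists X : seq 'M[F]_n,
    (forall x, x \in X -> word (n * n)%N x) /\
    (forall k x, word k x -> x \in <<X>>%VS).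
Proof.
move=> word.
have /choice[X XP] k := exists_spanning_seq (word k).
have Xle k : (<<X k>> <= <<X k.+1>>)%VS.
  apply/span_subvP => x /((XP k).1) [w [sw Pw ->]].
  by apply: (XP k.+1).2; exists w; split=> //; exact: leqW.
have [[k kn stab]|nstab] := EM (exists2 k, (k <= n * n)%N & (<<X k.+1>> <= <<X k>>)%VS).
  exists (X k); split=> [x /((XP k).1) [w [sw Pw ->]]|].
    by exists w; split=> //; exact: leq_trans kn.
  move=> j x [w [_ Pw ->]] {j x}; elim/last_ind: w Pw => [|w m IH] Pw.
    by apply: (XP k).2; exists nil; split=> //; rewrite big_nil.
  rewrite -cats1 big_cat big_seq1.
  have /IH : forall m, m \in w -> P m by move=> m' m'w; apply: Pw; rewrite mem_rcons inE m'w orbT.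
  move: (\prod_(m <- w) m) => y.
  apply: (span_ind (Q := fun y => y *m m \in <<X k>>%VS)) => {y}.
  - by rewrite mul0mx mem0v.
  - by move=> c u v um vm; rewrite mulmxDl -scalemxAl rpredD// rpredZ.
  move=> x /((XP k).1) [u [su Pu ->]].
  apply: (subvP stab); apply: (XP k.+1).2.
  exists (rcons u m); split; first by rewrite size_rcons ltnS.
    move=> m'; rewrite mem_rcons inE => /predU1P[->|/Pu//].
    by apply: Pw; rewrite mem_rcons mem_head.
  by rewrite -cats1 big_cat big_seq1.
have grow k : (k <= (n * n).+1)%N -> (k <= \dim <<X k>>)%N.
  elim: k => // k IH kn; apply: (leq_ltn_trans (IH (ltnW kn))).
  rewrite ltnNge; apply/negP => le; case: nstab; exists k => //.
  by have /eqP -> : <<X k>>%VS == <<X k.+1>>%VS by rewrite eqEdim Xle.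
have := leq_trans (grow _ (leqnn _)) (dimvS (subvf _)).
by rewrite dimvf /dim /= ltnn.
Qed.

Lemma mxtrace_idempotent (F : fieldType) (n : nat) (e : 'M[F]_n) :
  e *m e = e -> \tr e = (\rank e)%:R.
Proof.
move=> ee; rewrite -{1}(mulmx_base e) mxtrace_mulC.
suff -> : row_base e *m col_base e = 1%:M by rewrite mxtrace1.
have := ee; rewrite -{1 2 3}(mulmx_base e) => E.
have {}E : col_base e *m ((row_base e *m col_base e) *m row_base e)
         = col_base e *m row_base e by rewrite -E !mulmxA.
have /row_freeP[B RB] : row_free (row_base e) by exact: row_base_free.
have /row_fullP[C CB] : row_full (col_base e) by exact: col_base_full.
move: (row_base e) (col_base e) RB CB E => r c RB CB /(congr1 (fun M => C *m M *m B)).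
by rewrite /= !mulmxA CB !mul1mx -!mulmxA RB !mulmx1.
Qed.

(* Otherwise, by Fitting's lemma, a nonzero idempotent is a polynomial in [x]
   without constant term; its trace is both 0 and its rank. *)
Lemma nilpotent_of_mxtrace (F : numFieldType) (n : nat) (x : 'M[F]_n) :
  (forall k, \tr (x ^+ k.+1) = 0) -> exists k, x ^+ k = 0.
Proof.
case: n x => [|n] x tr0; first by exists 0%N; apply/matrixP => - [].
have [k [q]] := multiplicity_XsubC (char_poly x) 0.
have p0 : char_poly x != 0 by rewrite monic_neq0// char_poly_monic.
rewrite p0 /= => q0; rewrite polyC0 subr0 => pE.
have cop : coprimep q 'X^(k.+1).
  by apply: coprimep_expr; rewrite -['X]subr0 -polyC0 coprimep_XsubC.
have [[u v] /= /eqpP[[c d] /= /andP[c0 d0] uv]] := Bezout_coprimepP _ _ cop.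
pose s : {poly F} := (c / d) *: u; pose r : {poly F} := (c / d) *: v.
have sr : s * q + r * 'X^(k.+1) = 1.
  rewrite /s /r -!scalerAl -scalerDr mulrC -scalerA uv scalerA mulVf//.
  by rewrite scale1r.
have hp : horner_mx x (q * 'X^k) = 0.
  by rewrite -pE; exact: Cayley_Hamilton.
pose e := horner_mx x (r * 'X^(k.+1)).
have e1 : e = 1 - horner_mx x (s * q) by rewrite /e -(rmorph1 (horner_mx x)) -sr rmorphD /= addrC addKr.
have ee : e *m e = e.
  rewrite -[_ *m _]/(e * e) {2}e1 mulrBr mulr1 /e -rmorphM /=.
  have -> : r * 'X^(k.+1) * (s * q) = (q * 'X^k) * ('X * r * s) by rewrite exprS; ring.
  by rewrite [horner_mx x (q * _ * _)]rmorphM /= hp mul0r subr0.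
have tre : \tr e = 0.
  rewrite /e.
  have -> : r * 'X^(k.+1) = \sum_(i < size r) r`_i *: 'X^((i + k).+1).
    rewrite -[r in LHS]coefK poly_def mulr_suml; apply: eq_bigr => i _.
    by rewrite -scalerAl -exprD addnS.
  rewrite rmorph_sum raddf_sum big1// => i _.
  by rewrite /= horner_mxZ rmorphXn /= horner_mx_X mxtraceZ tr0 mulr0.
have e0 : e = 0.
  apply/eqP; rewrite -mxrank_eq0 -(pnatr_eq0 F) -mxtrace_idempotent//.
  exact/eqP.
exists k; have : horner_mx x 'X^k * (e + horner_mx x (s * q)) = x ^+ k.
  by rewrite e1 subrK mulr1 rmorphXn /= horner_mx_X.
move=> <-; rewrite e0 add0r -rmorphM /=.
have -> : 'X^k * (s * q) = (q * 'X^k) * s by ring.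
by rewrite rmorphM /= hp mul0r.
Qed.

Lemma exists_min_image (T : Type) (P : T -> Prop) (m : T -> nat) :
  (exists x, P x) -> exists2 x, P x & forall y, P y -> (m x <= m y)%N.
Proof.
move=> [x0 Px0].
have ex : exists k, `[< exists2 x, P x & m x = k >].
  by exists (m x0); apply/asboolP; exists x0.
case: (ex_minnP ex) => k /asboolP[x Px <-] min.
by exists x => // y Py; apply: min; apply/asboolP; exists y.
Qed.

(* The kernel [I] of the trace form on the algebra [U] spanned by [A] is an ideal of
   nilpotent matrices containing all [x - 1].  [K k] is the space of vectors killed
   by all products of [k] elements of [I]; it grows with [k] until it is the whole
   space: a vector w outside [K k] such that w U has minimal dimension satisfies
   w I <= K k, for otherwise w = w x y with x y in [I] nilpotent. *)
Lemma unipotent_of_mxtrace (F : numFieldType) (n : nat) (A : 'M[F]_n -> Prop) :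
  A 1 -> (forall x y, A x -> A y -> A (x * y)) ->
  (forall x, A x -> \tr x = n%:R) ->
  exists k, forall w : seq 'M[F]_n, size w = k -> (forall x, x \in w -> A x) ->
    \prod_(x <- w) (x - 1) = 0.
Proof.
move=> A1 AM trA.
have [X [XA AX]] := exists_spanning_seq A.
pose U := <<X>>%VS.
have UM x y : x \in U -> y \in U -> x * y \in U.
  move=> xU yU; move: x xU; apply: span_ind => [|c u v uU vU|x /XA xA].
  - by rewrite mul0r mem0v.
  - by rewrite -mulmxE mulmxDl -scalemxAl rpredD// rpredZ.
  move: y yU; apply: span_ind => [|c u v uU vU|y /XA yA].
  - by rewrite mulr0 mem0v.
  - by rewrite -mulmxE mulmxDr -scalemxAr rpredD// rpredZ.
  exact/AX/AM.
have U1 : 1 \in U by exact: AX.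
pose I x := x \in U /\ forall y, y \in U -> \tr (x * y) = 0.
have AI x : A x -> I (x - 1).
  move=> xA; split; first by rewrite rpredB//; exact: AX.
  apply: span_ind => [|c u v uU vU|y /XA yA].
  - by rewrite mulr0 mxtrace0.
  - by rewrite -mulmxE mulmxDr -scalemxAr mxtraceD mxtraceZ uU vU mulr0 addr0.
  by rewrite mulrBl mul1r raddfB /= !trA ?subrr//; exact: AM.
have IM x y : I x -> y \in U -> I (x * y).
  move=> [xU xI] yU; split; first exact: UM.
  by move=> z zU; rewrite -mulrA xI// UM.
have Inil x : I x -> exists k, x ^+ k = 0.
  move=> [xU xI]; apply: nilpotent_of_mxtrace => k; rewrite exprS xI//.
  by elim: k => [|k IH]; rewrite ?expr0// exprS UM.
pose K k (v : 'rV[F]_n) := forall w : seq 'M[F]_n, size w = k ->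
  (forall x, x \in w -> I x) -> v *m \prod_(x <- w) x = 0.
have K0 k : K k 0 by move=> w _ _; rewrite mul0mx.
have KD k c u v : K k u -> K k v -> K k (c *: u + v).
  move=> Ku Kv w sw wI; rewrite mulmxDl -scalemxAl Ku// Kv// scaler0 add0r//.
have KS k v : K k v -> K k.+1 v.
  move=> Kv; case/lastP=> // w x; rewrite size_rcons => -[sw] wI.
  rewrite -cats1 big_cat /= -mulmxE mulmxA Kv ?mul0mx// => y yw; apply: wI.
  by rewrite mem_rcons inE yw orbT.
have step k : (exists v, ~ K k v) -> exists2 v, K k.+1 v & ~ K k v.
  pose d (w : 'rV[F]_n) := \dim <<[seq w *m x | x <- X]>>.
  have inS (w : 'rV[F]_n) x : x \in U -> w *m x \in <<[seq w *m x | x <- X]>>%VS.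
    move: x; apply: span_ind => [|c u v uU vU|y yX].
    - by rewrite mulmx0 mem0v.
    - by rewrite mulmxDr -scalemxAr rpredD// rpredZ.
    by apply/memv_span/mapP; exists y.
  move=> /(exists_min_image d) [w nKw wmin]; exists w => //.
  case=> // x u [su] uI.
  rewrite big_cons -mulmxE mulmxA.
  suff : K k (w *m x) by apply=> // y yu; apply: uI; rewrite inE yu orbT.
  apply: contrapT => /[dup] nK /wmin dle.
  have xI : I x by apply: uI; rewrite mem_head.
  have le : (<<[seq w *m x *m y | y <- X]>> <= <<[seq w *m y | y <- X]>>)%VS.
    apply/span_subvP => _ /mapP[y yX ->]; rewrite -mulmxA; apply: inS.
    by apply: UM; [case: xI|exact: memv_span].
  have /eqP eqS : (<<[seq w *m x *m y | y <- X]>> == <<[seq w *m y | y <- X]>>)%VS.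
    by rewrite eqEdim le.
  have wS : w \in <<[seq w *m x *m y | y <- X]>>%VS.
    by rewrite eqS -[w in w \in _]mulmx1; exact: inS.
  have [y yU wE] : exists2 y, y \in U & w = w *m x *m y.
    move: wS; apply: (span_ind (Q := fun z => exists2 y, y \in U & z = w *m x *m y)) => [|c u1 u2|_ /mapP[y yX ->]].
    - by exists 0; rewrite ?mem0v ?mulmx0.
    - move=> [y1 y1U ->] [y2 y2U ->]; exists (c *: y1 + y2).
        by rewrite rpredD// rpredZ.
      by rewrite mulmxDr -scalemxAr.
    by exists y => //; exact: memv_span.
  have [m xy0] := Inil _ (IM _ _ xI yU).
  have wm j : w = w *m (x * y) ^+ j.
    elim: j => [|j IH]; first by rewrite expr0 mulmx1.
    by rewrite exprSr -mulmxE mulmxA -IH mulmxA.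
  by apply: nKw; rewrite (wm m) xy0 mulmx0.
have [k Kall] : exists k, forall v, K k v.
  apply: contrapT => nk.
  have {}nk k : exists v, ~ K k v.
    by apply: contrapT => nv; apply: nk; exists k => v; apply: contrapT => ?; apply: nv; exists v.
  have /choice[Y YP] k := exists_spanning_seq (K k).
  have KY k v : v \in <<Y k>>%VS -> K k v.
    by move: v; apply: span_ind => [|c u v|y /(YP k).1//]; [exact: K0|exact: KD].
  have grow k : (k <= \dim <<Y k>>)%N.
    elim: k => // k IH; apply: (leq_ltn_trans IH).
    have le : (<<Y k>> <= <<Y k.+1>>)%VS.
      by apply/span_subvP => y /(YP k).1 /KS; exact: (YP k.+1).2.
    rewrite ltnNge; apply/negP => dle.
    have /eqP eqY : <<Y k>>%VS == <<Y k.+1>>%VS by rewrite eqEdim le.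
    have [v Kv nKv] := step k (nk k).
    by apply: nKv; apply: KY; rewrite eqY; exact: (YP k.+1).2.
  have := leq_trans (grow (dim 'rV[F]_n).+1) (dimvS (subvf _)).
  by rewrite dimvf ltnn.
exists k => w sw wA; apply/row_matrixP => i; rewrite rowE row0.
rewrite -(big_map (fun x => x - 1) xpredT id); apply: Kall; first by rewrite size_map.
by move=> _ /mapP[x /wA xA ->]; exact: AI.
Qed.

Lemma char_poly_tr (R : comNzRingType) (n : nat) (T : 'M[R]_n) :
  char_poly T^T = char_poly T.
Proof.
rewrite /char_poly -[RHS]det_tr; congr (\det _).
by apply/matrixP => i j; rewrite !mxE eq_sym.
Qed.

Lemma mxtrace_le (n : nat) (T : 'M[algC]_n) (b : algC) :
  (forall (l : algC) (v : 'cV_n), v != 0 -> T *m v = l *: v -> `|l| <= b) ->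
  `|\tr T| <= b *+ n.
Proof.
case: n T => [|n] T Tb; first by rewrite /mxtrace big_ord0 normr0 mulr0n.
have [s sE] := closed_field_poly_normal (char_poly T).
have /monicP lc := char_poly_monic T; rewrite lc scale1r in sE.
have sz : size s = n.+1.
  by apply: succn_inj; rewrite -[(size s).+1](size_prod_XsubC s id) -sE size_char_poly.
have trE : \tr T = \sum_(z <- s) z.
  apply: oppr_inj; rewrite -char_poly_trace// sE /=.
  have -> : n = (size s).-1 by rewrite sz.
  by rewrite coefPn_prod_XsubC// sz.
rewrite trE -sz; apply: le_trans (ler_norm_sum _ _ _) _.
have : forall z, z \in s -> `|z| <= b.
  move=> z zs; have : root (char_poly T^T) z by rewrite char_poly_tr sE root_prod_XsubC.
  rewrite -eigenvalue_root_char => /eigenvalueP[v vz v0].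
  apply: (Tb z v^T); first by rewrite -(inj_eq (@trmx_inj _ _ _)) trmxK trmx0.
  by apply: trmx_inj; rewrite trmx_mul trmxK vz linearZ /= trmxK.
elim: (s) => [_|z r IH bs]; first by rewrite big_nil mulr0n.
rewrite big_cons mulrS lerD ?bs ?mem_head// IH// => x xr.
by apply: bs; rewrite inE xr orbT.
Qed.

Definition horner_bits (R : nzRingType) (l : R) : seq bool -> R :=
  foldl (fun x (b : bool) => x * l + b%:R) 0.

Lemma horner_bits_rcons (R : nzRingType) (l : R) e b :
  horner_bits l (rcons e b) = horner_bits l e * l + b%:R.
Proof. by rewrite /horner_bits -cats1 foldl_cat. Qed.

(* Two distinct values are at distance at least 1, by induction on the length. *)
Lemma horner_bits_inj (l : algC) (e e' : seq bool) : 2 <= `|l| ->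
  size e = size e' -> horner_bits l e = horner_bits l e' -> e = e'.
Proof.
move=> l2; set h := horner_bits l => see' hee'.
have key : forall (e e' : seq bool), size e = size e' -> e <> e' -> 1 <= `|h e - h e'|.
  move=> {e e' see' hee'}; elim/last_ind=> [|e b IH] e'; first by case: e'.
  case/lastP: e' => [|e' b']; rewrite ?size_rcons// => -[see'] ne.
  rewrite /h !horner_bits_rcons -/(h e) -/(h e').
  have -> : h e * l + b%:R - (h e' * l + b'%:R) = (h e - h e') * l + (b%:R - b'%:R) by ring.
  have d1 : `|b%:R - b'%:R| <= 1 :> algC.
    by case: b b' {ne} => - []; rewrite /= ?subrr ?subr0 ?sub0r ?normrN ?normr1 ?normr0// ler01.
  have [E|/eqP/(IH _ see') ge1] := eqVneq e e'.
    move: ne; rewrite E subrr mul0r add0r.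
    by case: b b' {d1} => - []//= _; rewrite ?subr0 ?sub0r ?normrN normr1.
  have := lerB_normD ((h e - h e') * l) (b%:R - b'%:R).
  apply: le_trans; rewrite normrM lerBrDr.
  apply: le_trans (_ : 1 + 1 <= _); first by rewrite lerD2l.
  by rewrite -[1 + 1]mul1r; apply: ler_pM; rewrite ?addr_ge0 ?ler01.
apply: contrapT => ne; have := key _ _ see' ne.
by rewrite hee' subrr normr0 ler10.
Qed.

(* Coordinates on Z^r / P modulo torsion, read off the Smith normal form of a
   matrix whose rows are elements of P spanning P over the rationals. *)
Lemma int_quotient_coords (r : nat) (P : 'rV[int]_r -> Prop) :
  P 0 -> (forall u v, P u -> P v -> P (u - v)) ->
  exists (n : nat) (C : 'M[int]_(r, n)) (m : nat),
    [/\ (0 < m)%N, forall v, P v -> v *m C = 0,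
      forall v, v *m C = 0 -> P (v *+ m) &
      forall w : 'rV_n, exists v, v *m C = w].
Proof.
move=> P0 PB.
have PN u : P u -> P (- u) by move=> Pu; rewrite -sub0r; exact: PB.
have PD u v : P u -> P v -> P (u + v).
  by move=> Pu Pv; rewrite -[v]opprK; apply: PB => //; exact: PN.
have PZ (c : int) u : P u -> P (c *: u).
  move=> Pu; elim/int_rect: c => [|k IH|k IH]; first by rewrite scale0r.
    by rewrite intS scalerDl scale1r; exact: PD.
  by rewrite intS opprD scalerDl scaleN1r addrC; exact: PB.
pose toQ k l (A : 'M[int]_(k, l)) : 'M[rat]_(k, l) := map_mx intr A.
have [X [XP PX]] := exists_spanning_seq (fun v : 'rV[rat]_r => exists2 u, P u & v = toQ _ _ u).
pose k := size X.
have /choice[b bP] (i : 'I_k) : exists u, P u /\ X`_i = toQ _ _ u.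
  by have [u Pu uE] := XP _ (mem_nth 0 (ltn_ord i)); exists u.
pose M : 'M[int]_(k, r) := \matrix_i b i.
have spanM v : P v -> exists c : 'rV[rat]_k, toQ _ _ v = c *m toQ _ _ M.
  move=> Pv; have /(@coord_span _ _ _ (in_tuple X)) -> : toQ _ _ v \in <<X>>%VS.
    by apply: PX; exists v.
  exists (\row_i coord (in_tuple X) i (toQ _ _ v)).
  rewrite mulmx_sum_row; apply: eq_bigr => i _; rewrite mxE.
  by rewrite -map_row rowK (bP i).2.
have PM c : P (c *m M).
  rewrite mulmx_sum_row; elim/big_ind: _ => // i _; apply: PZ.
  by rewrite rowK; exact: (bP i).1.
have [L uL [U uU [d _ ME]]] := int_Smith_normal_form M.
set Delta := (\matrix_(i, j) _) in ME.
pose T := [pred j : 'I_r | (k <= j)%N || (d`_j == 0)].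
pose f (i : 'I_#|T|) : 'I_r := enum_val i.
pose m := (\prod_(i < r) (if (d`_i == 0)%R then 1 else `|(d`_i)%R|))%N.
have m_gt0 : (0 < m)%N.
  by rewrite prodn_gt0// => i; case: eqP => // /eqP; rewrite absz_gt0.
exists #|T|, (colsub f (invmx U)), m; split=> // [v Pv|v vC|w].
- rewrite mulmx_colsub; apply/matrixP => i j; rewrite ord1 !mxE.
  have [c cE] := spanM v Pv.
  suff : toQ _ _ (v *m invmx U) 0 (f j) = 0 by rewrite mxE => /eqP; rewrite intr_eq0 mxE => /eqP.
  rewrite /toQ map_mxM /= -/(toQ _ _ v) cE ME /toQ !map_mxM /= -!mulmxA -map_mxM mulmxV//.
  rewrite map_mx1 mulmx1 mulmxA mxE big1// => l _.
  rewrite !mxE; have := enum_valP j; rewrite -/(f j) inE => fjT.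
  case: eqP => [lj|_]; last by rewrite mulr0n mulr0.
  by move: fjT; rewrite -lj leqNgt ltn_ord /= => /eqP ->; rewrite mul0rn mulr0.
- have [w wE] : exists w, w = v *m invmx U by exists (v *m invmx U).
  have wT j : T j -> w 0 j = 0.
    move=> Tj; have := congr1 (fun A : 'rV_ _ => A 0 (enum_rank_in Tj j)) vC.
    by rewrite mulmx_colsub !mxE /f enum_rankK_in// => <-; rewrite wE mxE.
  pose e : 'rV[int]_k := \row_(i < k) (if (insub (i : nat) : option 'I_r) is Some j then divz (w 0 j *+ m) d`_i else 0).
  have eD : e *m Delta = w *+ m.
    apply/rowP => j; rewrite mulmxnE mxE.
    have [jk|kj] := ltnP j k; last first.
      rewrite big1 => [|i _]; last first.
        rewrite !mxE; case: eqP => [ij|_]; last by rewrite mulr0n mulr0.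
        by move: kj; rewrite -ij leqNgt ltn_ord.
      by rewrite wT ?mul0rn//= kj.
    rewrite (bigD1 (Ordinal jk))//= big1 => [|i]; last first.
      rewrite !mxE -val_eqE /= => /negPf ij; by rewrite ij mulr0n mulr0.
    rewrite addr0 !mxE eqxx mulr1n insubT//= => jr.
    have -> : Sub (j : nat) jr = j by exact: val_inj.
    have [dj0|dj0] := eqVneq d`_j 0.
      by rewrite dj0 mulr0 wT ?mul0rn//= dj0 eqxx orbT.
    rewrite divzK// -mulr_natr natz.
    apply: dvdz_mull; rewrite /m (bigD1 j)//= (negPf dj0).
    by rewrite PoszM; apply: dvdz_mulr; rewrite dvdzE.
  have -> : v *+ m = e *m invmx L *m M.
    by rewrite ME !mulmxA mulmxKV// eD wE -[in RHS]scaler_nat -scalemxAl mulmxKV// scaler_nat.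
  exact: PM.
- exists (w *m rowsub f U); rewrite -mulmxA.
  suff -> : rowsub f U *m colsub f (invmx U) = 1%:M by rewrite mulmx1.
  rewrite mulmx_colsub mul_rowsub_mx mulmxV//.
  by apply/matrixP => i j; rewrite !mxE (inj_eq enum_val_inj).
Qed.

Local Close Scope ring_scope.
Local Open Scope classical_set_scope.
Local Open Scope group_scope.

(** * Subgroups, index and word balls *)

Lemma pigeonhole_ord (d : nat) (f : 'I_d.+1 -> 'I_d) :
  exists i j : 'I_d.+1, (i < j)%N /\ f i = f j.
Proof.
have /injectivePn[i [j]] : ~~ injectiveb f.
  by apply/negP => /injectiveP/leq_card; rewrite !card_ord ltnn.
rewrite -val_eqE neq_ltn => /orP[lt|lt] eqf; first by exists i, j.
by exists j, i.
Qed.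

Section Subgroups.
Context {G : groupType}.
Implicit Types (H K L S : set G) (x y z g t : G).

Lemma is_subgroupP H :
  is_subgroup H <-> H 1 /\ forall x y, H x -> H y -> H (x * y^-1).
Proof.
split=> [[/set_mem H1 HF]|[H1 HF]]; split.
- by [].
- by move=> x y Hx Hy; apply/set_mem/HF; apply/mem_set.
- exact/mem_set.
- by move=> x y /set_mem Hx /set_mem Hy; apply/mem_set/HF.
Qed.

Lemma sg1 H : is_subgroup H -> H 1.
Proof. by case/is_subgroupP. Qed.

Lemma sgV H x : is_subgroup H -> H x -> H x^-1.
Proof. by move=> /is_subgroupP[H1 HF] Hx; rewrite -[x^-1]mul1g; exact: HF. Qed.

Lemma sgM H x y : is_subgroup H -> H x -> H y -> H (x * y).
Proof.
move=> sH Hx Hy; rewrite -[y]invgK; have [_ HF] := (is_subgroupP H).1 sH.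
by apply: HF => //; exact: sgV.
Qed.

Lemma sgX H x n : is_subgroup H -> H x -> H (x ^+ n).
Proof.
move=> sH Hx; elim: n => [|n IH]; first by rewrite expg0; exact: sg1.
by rewrite expgS; exact: sgM.
Qed.

Lemma sgJ H x y : is_subgroup H -> H x -> H y -> H (x ^ y).
Proof. by move=> sH Hx Hy; rewrite conjgE; do !apply: sgM => //; exact: sgV. Qed.

Lemma sgR H x y : is_subgroup H -> H x -> H y -> H [~ x, y].
Proof. by move=> sH Hx Hy; rewrite commgEl; apply: sgM => //; [exact: sgV|exact: sgJ]. Qed.

Lemma sg_prod H (s : seq G) : is_subgroup H -> (forall x, x \in s -> H x) ->
  H (\prod_(x <- s) x).
Proof.
move=> sH; elim: s => [|x s IH] Hs; first by rewrite big_nil; exact: sg1.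
rewrite big_cons; apply: sgM => //; first by apply: Hs; rewrite mem_head.
by apply: IH => y ys; apply: Hs; rewrite inE ys orbT.
Qed.

Lemma is_subgroup_mk H : H 1 -> (forall x y, H x -> H y -> H (x * y)) ->
  (forall x, H x -> H x^-1) -> is_subgroup H.
Proof. by move=> H1 HM HV; apply/is_subgroupP; split=> // x y Hx /HV Hy; exact: HM. Qed.

Lemma is_subgroup1 : is_subgroup [set 1 : G].
Proof.
by apply: is_subgroup_mk => [|x y -> ->|x ->] /=; rewrite ?mulg1 ?invg1.
Qed.

Lemma is_subgroupI H K : is_subgroup H -> is_subgroup K -> is_subgroup (H `&` K).
Proof.
move=> sH sK; apply: is_subgroup_mk.
- by split; exact: sg1.
- by move=> x y [? ?] [? ?]; split; exact: sgM.
- by move=> x [? ?]; split; exact: sgV.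
Qed.

Lemma gen_subgroup S : is_subgroup (smallest is_subgroup S).
Proof.
apply: is_subgroup_mk.
- by move=> H [sH _]; exact: sg1.
- by move=> x y Hx Hy H /[dup] HH [sH _]; apply: sgM => //; [exact: Hx|exact: Hy].
- by move=> x Hx H /[dup] HH [sH _]; apply: sgV => //; exact: Hx.
Qed.

Lemma sub_gen S : S `<=` smallest is_subgroup S.
Proof. by move=> x Sx H [_]; exact. Qed.

Lemma gen_sub S H : is_subgroup H -> S `<=` H -> smallest is_subgroup S `<=` H.
Proof. by move=> sH SH x; exact. Qed.

(* Finite index of H in K, witnessed by a function with finitely many values that
   separates the right cosets of H in K. *)
Definition fin_index H K := exists (d : nat) (phi : G -> 'I_d),
  forall x y, K x -> K y -> phi x = phi y -> H (x * y^-1).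

Lemma fin_index_refl H : is_subgroup H -> fin_index H H.
Proof.
move=> sH; exists 1%N, (fun=> ord0) => x y Hx Hy _.
by apply: sgM => //; exact: sgV.
Qed.

Lemma fin_index_finType (T : finType) (phi : G -> T) H K :
  (forall x y, K x -> K y -> phi x = phi y -> H (x * y^-1)) -> fin_index H K.
Proof.
move=> phiP; exists #|T|, (fun x => enum_rank (phi x)) => x y Kx Ky.
by move=> /enum_rank_inj; exact: phiP.
Qed.

Lemma fin_index_trans H K L : fin_index H K -> fin_index K L -> fin_index H L.
Proof.
move=> [d [phi phiP]] [e [psi psiP]].
have /choice[r rP] (i : 'I_e) : exists r, (exists2 x, L x & psi x = i) -> L r /\ psi r = i.
  have [[x Lx xi]|nx] := EM (exists2 x, L x & psi x = i); first by exists x.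
  by exists 1.
apply: (@fin_index_finType _ (fun x => (psi x, phi (x * (r (psi x))^-1)))).
move=> x y Lx Ly [psixy]; have [Lr rx] : L (r (psi x)) /\ psi (r (psi x)) = psi x.
  by apply: rP; exists x.
rewrite -psixy => /phiP; rewrite invgM invgK mulgA mulgVK; apply.
  exact: psiP.
by apply: psiP => //; rewrite rx.
Qed.

Lemma fin_index_expg H K x : is_subgroup H -> is_subgroup K -> fin_index H K -> K x ->
  exists2 m, (0 < m)%N & H (x ^+ m).
Proof.
move=> sH sK [d [phi phiP]] Kx.
have [i [j [lt eqij]]] := pigeonhole_ord (fun i : 'I_d.+1 => phi (x ^+ i)).
exists (j - i)%N; first by rewrite subn_gt0.
rewrite expgnFr ?(ltnW lt)//; apply: phiP; rewrite ?eqij//; exact: sgX.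
Qed.

Lemma finite_index_fin_index H : is_subgroup H -> finite_index H -> fin_index H [set: G].
Proof.
move=> sH /finite_seqP[s sE].
have mem x : lcoset_set x^-1 H \in s.
  have : [set lcoset_set x H | x in [set: G]] (lcoset_set x^-1 H) by exists x^-1.
  by rewrite sE.
apply: (@fin_index_finType _ (fun x => SeqSub (mem x))) => x y _ _ [].
move=> E; have : lcoset_set y^-1 H y^-1 by exists 1; rewrite ?mulg1//; exact: sg1.
rewrite -E => -[h Hh <-]; by rewrite mulVKg.
Qed.

Lemma is_word0 S : is_word S 0 1.
Proof. by exists nil; split=> //; rewrite big_nil. Qed.

Lemma is_wordM S m n x y : is_word S m x -> is_word S n y -> is_word S (m + n) (x * y).
Proof.
move=> [u [<- Su ->]] [v [<- Sv ->]]; exists (u ++ v); split.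
- by rewrite size_cat.
- by move=> s; rewrite mem_cat => /orP[/Su|/Sv].
- by rewrite big_cat.
Qed.

Lemma is_word1 S x : S x \/ S x^-1 -> is_word S 1 x.
Proof.
move=> Sx; exists [:: x]; split=> //; last by rewrite big_seq1.
by move=> s; rewrite inE => /eqP ->.
Qed.

Lemma is_wordV S n x : is_word S n x -> is_word S n x^-1.
Proof.
move=> [w [<- Sw ->]]; exists (rev [seq s^-1 | s <- w]); split.
- by rewrite size_rev size_map.
- move=> s; rewrite mem_rev => /mapP[r /Sw Sr ->]; rewrite invgK.
  by case: Sr; [right|left].
- by rewrite -map_rev big_map prodgV revK.
Qed.

Definition ball S (n : nat) : set G := [set g | exists2 m, (m <= n)%N & is_word S m g].

Lemma ball1 S n : ball S n 1.
Proof. by exists 0%N => //; exact: is_word0. Qed.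

Lemma ballM S m n x y : ball S m x -> ball S n y -> ball S (m + n) (x * y).
Proof.
move=> [i im ix] [j jn jy]; exists (i + j)%N; first exact: leq_add.
exact: is_wordM.
Qed.

Lemma ballV S n x : ball S n x -> ball S n x^-1.
Proof. by move=> [i im ix]; exists i => //; exact: is_wordV. Qed.

Lemma ball_mono S m n x : (m <= n)%N -> ball S m x -> ball S n x.
Proof. by move=> mn [i im ix]; exists i => //; exact: leq_trans mn. Qed.

Lemma ball_prod S k (w : seq G) : (forall x, x \in w -> ball S k x) ->
  ball S (size w * k) (\prod_(x <- w) x).
Proof.
elim: w => [|x w IH] Sw; first by rewrite big_nil; exact: ball1.
rewrite big_cons mulSn; apply: ballM; first by apply: Sw; rewrite mem_head.
by apply: IH => y yw; apply: Sw; rewrite inE yw orbT.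
Qed.

Lemma gen_word S x : smallest is_subgroup S x <-> exists n, is_word S n x.
Proof.
split.
  move: x; apply: gen_sub => [|x Sx]; last by exists 1%N; apply: is_word1; left.
  apply: is_subgroup_mk.
  - by exists 0%N; exact: is_word0.
  - by move=> x y [m mx] [n ny]; exists (m + n)%N; exact: is_wordM.
  - by move=> x [m mx]; exists m; exact: is_wordV.
move=> [n [w [_ Sw ->]]]; apply: sg_prod; first exact: gen_subgroup.
move=> s /Sw[|/sub_gen]; first exact: sub_gen.
by move=> /(sgV (gen_subgroup S)); rewrite invgK.
Qed.

Lemma is_word_sym S n x : (forall s, S s -> S s^-1) -> is_word S n x ->
  exists w : seq G, [/\ size w = n, forall s, s \in w -> S s & x = \prod_(s <- w) s].
Proof.
move=> SV [w [sw Sw ->]]; exists w; split=> // s /Sw[//|/SV].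
by rewrite invgK.
Qed.

Lemma short_coset_rep H : is_subgroup H -> fin_index H [set: G] ->
  exists d, forall S, smallest is_subgroup S = [set: G] ->
    forall g, exists2 r, ball S d r & H (g * r^-1).
Proof.
move=> sH [d [phi phiP]]; exists d => S genS g.
pose P n := `[< exists2 r, is_word S n r & H (g * r^-1) >].
have exP : exists n, P n.
  have [n gn] : exists n, is_word S n g by apply/gen_word; rewrite genS.
  by exists n; apply/asboolP; exists g => //; rewrite mulgV; exact: sg1.
case: (ex_minnP exP) => n /asboolP[r [w [sw Sw rE] Hgr]] nmin.
exists r => //; exists n; last by exists w.
rewrite leqNgt; apply/negP => dn.
have [i [j [lt eqij]]] := pigeonhole_ord (fun i : 'I_d.+1 => phi (\prod_(x <- take i w) x)).
have jn : (j <= n)%N by apply: leq_trans (ltnW dn); rewrite -ltnS ltn_ord.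
pose w' := take i w ++ drop j w.
have sw' : (size w' < n)%N.
  rewrite size_cat size_takel ?sw ?(leq_trans (ltnW lt))// size_drop sw.
  by rewrite -[in ltnRHS](subnKC jn) ltn_add2r.
suff /nmin : P (size w') by rewrite leqNgt sw'.
apply/asboolP; exists (\prod_(x <- w') x).
  exists w'; split=> // s; rewrite mem_cat => /orP[/mem_take|/mem_drop]; exact: Sw.
have -> : g * (\prod_(x <- w') x)^-1 =
    (g * r^-1) * (\prod_(x <- take j w) x * (\prod_(x <- take i w) x)^-1).
  by rewrite rE -{1}(cat_take_drop j w) !big_cat /= !invgM -!mulgA mulKg.
by apply: sgM => //; apply: phiP.
Qed.

Lemma schreier H : is_subgroup H -> fin_index H [set: G] -> exists d : nat, forall S,
  smallest is_subgroup S = [set: G] -> H `<=` smallest is_subgroup (H `&` ball S d).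
Proof.
move=> sH /(short_coset_rep sH)[d rep]; exists (d + 1 + d)%N => S genS.
set Q := smallest is_subgroup _ => h Hh.
have sQ : is_subgroup Q by exact: gen_subgroup.
have QH : Q `<=` H by apply: gen_sub => // x [].
have key g : exists2 r, ball S d r & Q (g * r^-1).
  have [n [w [_ Sw ->]]] : exists n, is_word S n g by apply/gen_word; rewrite genS.
  elim/last_ind: w Sw => [|w s IH] Sw.
    by exists 1; [exact: ball1|rewrite big_nil mulgV; exact: sg1].
  have [|r Sr Qr] := IH; first by move=> x xw; apply: Sw; rewrite mem_rcons inE xw orbT.
  have [r' Sr' Hr'] := rep _ genS (r * s); exists r' => //.
  rewrite -cats1 big_cat big_seq1 /=.
  have -> : \prod_(x <- w) x * s * r'^-1 = (\prod_(x <- w) x * r^-1) * (r * s * r'^-1).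
    by rewrite !mulgA mulgVK.
  apply: (sgM sQ Qr); apply: (sub_gen (S := H `&` _)); split=> //.
  have Ss : ball S 1 s.
    by exists 1%N => //; apply: is_word1; apply: Sw; rewrite mem_rcons mem_head.
  exact: (ballM (ballM Sr Ss) (ballV Sr')).
have [r Sr Qr] := key h.
rewrite -(mulgVK r h); apply: (sgM sQ Qr); apply: (sub_gen (S := H `&` _)); split.
  by rewrite -[r]invgK; apply: sgV => //; rewrite -(mulKg h r^-1);
    apply: sgM => //; [exact: sgV|exact: QH].
by apply: ball_mono Sr; rewrite -addnA leq_addr.
Qed.
End Subgroups.

(** * Polycyclic groups and central series *)

Section IntegerPowers.
Context {G : groupType}.
Implicit Types (x y : G) (a b : int).

Lemma expgz1 x : expgz x 1 = x. Proof. by []. Qed.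

Lemma expgzS x a : expgz x (a + 1)%R = expgz x a * x.
Proof.
case: a => [n|[|n]] /=.
- by rewrite addn1 expgSr.
- by rewrite expg1 mulVg expg0.
by rewrite subn1 /= [in RHS]expgS invgM mulgVK.
Qed.

Lemma expgzD x a b : expgz x (a + b)%R = expgz x a * expgz x b.
Proof.
elim/int_rect: b => [|n IH|n IH].
- by rewrite addr0 mulg1.
- by rewrite -addn1 PoszD addrA !expgzS IH mulgA.
apply: (mulIg x); rewrite -mulgA -!expgzS -addrA.
by have -> : (- n.+1%:Z + 1 = - n%:Z)%R by lia.
Qed.

Lemma expgzN x a : expgz x (- a)%R = (expgz x a)^-1.
Proof. by apply: (mulIg (expgz x a)); rewrite -expgzD addNr mulVg. Qed.

Lemma expgzM x a b : expgz x (a * b)%R = expgz (expgz x a) b.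
Proof.
elim/int_rect: b => [|n IH|n IH].
- by rewrite mulr0.
- by rewrite -addn1 PoszD mulrDr mulr1 !expgzD IH.
apply: (mulIg (expgz x a)); rewrite -expgzD -expgzS.
have -> : (a * - n.+1%:Z + a = a * - n%:Z)%R by lia.
by have -> : (- n.+1%:Z + 1 = - n%:Z)%R by lia.
Qed.

Lemma sgXz (H : set G) x a : is_subgroup H -> H x -> H (expgz x a).
Proof. by move=> sH Hx; case: a => n /=; [|apply: sgV => //]; exact: sgX. Qed.
End IntegerPowers.

Section Normal.
Context {G : groupType}.
Implicit Types (H K L E S : set G) (x y z g t : G).

Definition cg H x y := H (x^-1 * y).

Lemma cg_refl H x : is_subgroup H -> cg H x x.
Proof. by move=> sH; rewrite /cg mulVg; exact: sg1. Qed.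

Lemma cg_sym H x y : is_subgroup H -> cg H x y -> cg H y x.
Proof. by move=> sH /(sgV sH); rewrite invgM invgK. Qed.

Lemma cg_trans H y x z : is_subgroup H -> cg H x y -> cg H y z -> cg H x z.
Proof. by move=> sH xy /(sgM sH xy); rewrite mulgA mulgK. Qed.

Lemma normal_sub H K L : is_subgroup L -> H `<=` L -> L `<=` K -> normal_in H K ->
  normal_in H L.
Proof. by move=> sL HL LK [sH sK HK nH]; split=> // x y Hx /LK; exact: nH. Qed.

Lemma normalI H K L : is_subgroup L -> L `<=` K -> normal_in H K ->
  normal_in (L `&` H) L.
Proof.
move=> sL LK [sH sK HK nH]; split=> //; first exact: is_subgroupI.
by move=> x y [Lx Hx] Ly; split; [exact: sgJ|apply: nH => //; exact: LK].
Qed.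

Lemma cgM H K x y u v : normal_in H K -> K u -> cg H x y -> cg H u v ->
  cg H (x * u) (y * v).
Proof.
move=> [sH sK HK nH] Ku xy uv; rewrite /cg.
have -> : (x * u)^-1 * (y * v) = (x^-1 * y) ^ u * (u^-1 * v).
  by rewrite conjgE invgM !mulgA mulgK.
by apply: sgM => //; exact: nH.
Qed.

Lemma cgV H K x y : normal_in H K -> K x -> cg H x y -> cg H x^-1 y^-1.
Proof.
move=> [sH sK HK nH] Kx xy; rewrite /cg.
have -> : x^-1^-1 * y^-1 = (x^-1 * y)^-1 ^ x^-1.
  by rewrite conjgE invgM !invgK mulgK.
by apply: nH; [exact: sgV|exact: sgV].
Qed.

Lemma cgJ H K x y u : normal_in H K -> K u -> cg H x y -> cg H (x ^ u) (y ^ u).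
Proof. by move=> [sH sK HK nH] Ku xy; rewrite /cg -conjVg -conjMg; exact: nH. Qed.

Lemma cgX H K x y n : normal_in H K -> K x -> cg H x y -> cg H (x ^+ n) (y ^+ n).
Proof.
move=> nHK Kx xy; have [sH sK _ _] := nHK.
elim: n => [|n IH]; first by rewrite !expg0; exact: cg_refl.
by rewrite !expgS; apply: (cgM nHK) => //; exact: sgX.
Qed.

Lemma cgXz H K x y a : normal_in H K -> K x -> cg H x y -> cg H (expgz x a) (expgz y a).
Proof.
move=> nHK Kx xy; have [sH sK _ _] := nHK; case: a => n /=; first exact: cgX nHK _ _.
by apply: (cgV nHK); [exact: sgX|exact: cgX nHK _ _].
Qed.

Inductive polyc : set G -> Prop :=
| polyc1 : polyc [set 1]
| polycS H K t : polyc H -> normal_in H K -> K t ->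
    (forall x, K x -> exists a, cg H (expgz t a) x) -> polyc K.

Lemma polyc_subgroup K : polyc K -> is_subgroup K.
Proof. by case=> [|H L t _ []//]; exact: is_subgroup1. Qed.

Lemma int_subgroup_gen (J : int -> Prop) : (forall a b, J a -> J b -> J (a - b)%R) ->
  J 0%R -> exists2 d, J d & forall a, J a -> exists q, a = (d * q)%R.
Proof.
move=> JB J0.
have JN a : J a -> J (- a)%R by move=> Ja; rewrite -sub0r; exact: JB.
have JD a b : J a -> J b -> J (a + b)%R by move=> Ja Jb; rewrite -[b]opprK; apply: JB => //; exact: JN.
have JM d a : J d -> J (d * a)%R.
  move=> Jd; elim/int_rect: a => [|n IH|n IH]; first by rewrite mulr0.
    by rewrite -addn1 PoszD mulrDr mulr1; exact: JD.
  by rewrite -addn1 PoszD opprD mulrDr mulrN1; exact: JB.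
have [[n0 n0P]|none] := EM (exists n : nat, (0 < n)%N /\ J (Posz n)).
  have ex : exists n : nat, `[< (0 < n)%N /\ J (Posz n) >] by exists n0; apply/asboolP.
  case: (ex_minnP ex) => d /asboolP[d0 Jd] dmin.
  exists (Posz d) => // a Ja; exists (a %/ (Posz d))%Z.
  have aE := divz_eq a (Posz d).
  suff : (a %% (Posz d))%Z = 0%R by move=> r0; rewrite {1}aE r0 addr0 mulrC.
  have r_ge : (0 <= (a %% (Posz d))%Z)%R by apply: modz_ge0; lia.
  have r_lt : ((a %% (Posz d))%Z < Posz d)%R by apply: ltz_pmod; lia.
  have Jr : J (a %% (Posz d))%Z.
    have -> : (a %% (Posz d))%Z = (a - (Posz d) * (a %/ (Posz d))%Z)%R by rewrite {2}aE mulrC addrC addKr.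
    by apply: JB => //; exact: JM.
  case: (a %% (Posz d))%Z r_ge r_lt Jr => // -[//|r] _ rd Jr.
  have : (d <= r.+1)%N by apply: dmin; apply/asboolP.
  by move: rd; lia.
exists 0%R => // a Ja; exists 0%R; rewrite mulr0.
apply: contrapT => a0; apply: none; exists `|a|%N; split; first by lia.
have [->|->] // : Posz `|a|%N = a \/ Posz `|a|%N = (- a)%R by lia.
exact: JN.
Qed.

Lemma polyc_sub K L : polyc K -> is_subgroup L -> L `<=` K -> polyc L.
Proof.
move=> pK; elim: pK L => {K} [|H K t pH IH nHK Kt tP] L sL LK.
  suff -> : L = [set 1] by exact: polyc1.
  by apply/seteqP; split=> // x ->; exact: sg1.
have [sH sK HK nH] := nHK.
have nLH := normalI sL LK nHK.
pose J a := exists2 x, L x & cg H (expgz t a) x.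
have [||d [u Lu tu] dP] := @int_subgroup_gen J.
- move=> a b [x Lx ax] [y Ly bb]; exists (x * y^-1).
    by apply: sgM => //; exact: sgV.
  rewrite expgzD expgzN; apply: (cgM nHK) => //.
    by apply: sgV => //; exact: sgXz.
  by apply: (cgV nHK) => //; exact: sgXz.
- by exists 1; [exact: sg1|exact: cg_refl].
apply: (polycS (H := L `&` H) (t := u)) => //.
  by apply: IH => //; exact: is_subgroupI.
move=> x Lx; have [a ax] := tP _ (LK _ Lx).
have [|q aE] := dP a; first by exists x.
exists q; split.
  by apply: sgM => //; apply: sgV => //; exact: sgXz.
apply: (cg_trans (y := expgz t a)) => //; rewrite aE expgzM.
apply: cg_sym => //; apply: (cgXz _ nHK) => //; exact: sgXz.
Qed.

Lemma polyc_fg K : polyc K ->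
  exists s : seq G, (forall x, x \in s -> K x) /\ K `<=` smallest is_subgroup [set` s].
Proof.
elim=> {K} [|H K t pH [s [sH Hs]] [gH gK HK nH] Kt tP].
  by exists nil; split=> // x ->; exact: sg1 (gen_subgroup _).
exists (t :: s); split=> [x|x Kx]; first by rewrite inE => /predU1P[->//|/sH/HK].
have gts := gen_subgroup [set` t :: s].
have sub y : y \in t :: s -> smallest is_subgroup [set` t :: s] y by move=> yts; apply: sub_gen.
have [a ax] := tP x Kx; rewrite -(mulVKg (expgz t a) x); apply: (sgM gts).
  by apply: (sgXz _ gts); apply: sub; rewrite mem_head.
move/Hs: ax; move: (_ * _); apply: (gen_sub gts) => y ys; apply: sub.
by rewrite inE; apply/orP; right.
Qed.

Lemma cyclic_quotientP K H : is_subgroup H -> cyclic_quotient K H ->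
  exists2 t, K t & forall x, K x -> exists a, cg H (expgz t a) x.
Proof.
move=> sH [t Kt tP]; exists t => // x /tP[a aE]; exists a.
have : lcoset_set x H x by exists 1; [exact: sg1|rewrite mulg1].
by rewrite aE => -[h Hh <-]; rewrite /cg mulKg.
Qed.

Lemma polycyclic_series N : polycyclic N -> exists (k : nat) (D : nat -> set G),
  [/\ D 0%N = N, D k = [set 1], polyc N &
    forall j, normal_in (D j) N /\
    ((j < k)%N -> D j.+1 `<=` D j /\ forall x y, D j x -> D j y -> D j.+1 [~ x, y])].
Proof.
move=> [k [H [H0 Hk HP]]].
have cyc i : (i < k)%N -> normal_in (H i) (H i.+1) /\
    exists2 t, H i.+1 t & forall x, H i.+1 x -> exists a, cg (H i) (expgz t a) x.
  by move=> /HP[[sH ? ? ?] c]; split=> //; exact: cyclic_quotientP.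
have pH i : (i <= k)%N -> polyc (H i).
  elim: i => [|i IH] ik; first by rewrite H0; exact: polyc1.
  have [n [t Ht tP]] := cyc _ ik.
  by apply: (polycS _ n Ht tP); apply: IH; exact: ltnW.
have HN i : (i <= k)%N -> H i `<=` N.
  rewrite -Hk => /subnKC; move: (k - i)%N => j; elim: j i => [|j IH] i.
    by rewrite addn0 => ->.
  rewrite addnS => ik; have ik' : (i < k)%N by rewrite -ik ltnS leq_addr.
  have [[_ _ sub _] _] := cyc _ ik'.
  by apply: subset_trans sub _; apply: (IH i.+1); rewrite addSn.
have sN : is_subgroup N by rewrite -Hk; apply: polyc_subgroup; exact: pH.
have sH i : (i <= k)%N -> is_subgroup (H i) by move=> /pH/polyc_subgroup.
exists k, (fun j => [set g | forall x, N x -> H (k - j)%N (g ^ x)]); split=> /=.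
- rewrite subn0 Hk; apply/seteqP; split=> x /=.
    by move=> /(_ 1 (sg1 sN)); rewrite conjg1.
  by move=> Nx y Ny; exact: sgJ.
- rewrite subnn H0; apply/seteqP; split=> x /=.
    by move=> /(_ 1 (sg1 sN)); rewrite conjg1.
  by move=> -> y _; rewrite conj1g.
- by rewrite -Hk; exact: pH.
move=> j; have le : (k - j <= k)%N by exact: leq_subr.
split.
  split=> //.
  - apply: is_subgroup_mk => /=.
    + by move=> x _; rewrite conj1g; exact: sg1 (sH _ le).
    + by move=> x y Hx Hy z Nz; rewrite conjMg; apply: (sgM (sH _ le)); [exact: Hx|exact: Hy].
    + by move=> x Hx z Nz; rewrite conjVg; apply: (sgV (sH _ le)); exact: Hx.
  - by move=> x /(_ 1 (sg1 sN)); rewrite conjg1; exact: HN.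
  - by move=> x y Hx Ny z Nz; rewrite -conjgM; apply: Hx; exact: sgM.
move=> jk; have kj : (k - j = (k - j.+1).+1)%N by rewrite -subSn// subSS.
have ik : (k - j.+1 < k)%N by rewrite ltn_subrL (leq_ltn_trans _ jk).
split=> [x Hx z Nz|x y Hx Hy z Nz].
  by rewrite kj; have [[_ _ sub _] _] := cyc _ ik; apply/sub/Hx.
rewrite conjRg; have {Hx}Hx := Hx _ Nz; have {Hy}Hy := Hy _ Nz.
move: (x ^ z) (y ^ z) Hx Hy => {}x {}y.
rewrite kj; have [nH [t Ht tP]] := cyc _ ik; move: nH Ht tP; set i := (k - j.+1)%N => nH Ht tP.
move=> Hx Hy; have [a ax] := tP _ Hx; have [b bY] := tP _ Hy.
have [sHi sHi1 _ _] := nH.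
have -> : [~ x, y] = (y * x)^-1 * (x * y) by rewrite commgEl conjgE invgM !mulgA.
have taK c := sgXz c sHi1 Ht.
apply: (cg_trans (y := expgz t (a + b)%R)) => //.
  by apply: cg_sym => //; rewrite addrC expgzD; exact: cgM nH (taK _) _ _.
by rewrite expgzD; exact: cgM nH (taK _) _ _.
Qed.

(* [ucs H E i x]: x lies in the i-th term of the upper central series of H modulo
   E; membership of x in H is not included. *)
Fixpoint ucs H E i x : Prop :=
  if i is j.+1 then forall h, H h -> ucs H E j [~ x, h] else E x.

Section Ucs.
Variables (H E : set G).
Hypotheses (sH : is_subgroup H) (sE : is_subgroup E).
Hypothesis nE : forall x y, E x -> H y -> E (x ^ y).

Lemma ucsJ i x y : ucs H E i x -> H y -> ucs H E i (x ^ y).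
Proof.
elim: i x => [|i IH] x /= ux Hy; first exact: nE.
move=> h Hh; rewrite -(conjgKV y h) -conjRg; apply: IH => //.
by apply: ux; apply: sgJ => //; exact: sgV.
Qed.

Lemma ucs_1 i : ucs H E i 1.
Proof. by elim: i => [|i IH] /=; [exact: sg1|move=> h _; rewrite comm1g]. Qed.

Lemma ucsMV i : (forall x y, H y -> ucs H E i x -> ucs H E i y -> ucs H E i (x * y)) /\
  (forall x, H x -> ucs H E i x -> ucs H E i x^-1).
Proof.
elim: i => [|i [IHM IHV]] /=; first by split=> *; [exact: sgM|exact: sgV].
split=> [x y Hy ux uy h Hh|x Hx ux h Hh].
  have -> : [~ x * y, h] = [~ x, h] ^ y * [~ y, h].
    by rewrite !commgEl !conjMg !conjgE !invgM !mulgA !mulgK.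
  by apply: IHM; [exact: sgR|apply: ucsJ => //; exact: ux|exact: uy].
have -> : [~ x^-1, h] = [~ x, h]^-1 ^ x^-1.
  by rewrite !commgEl !conjgE !invgM !invgK !mulgA mulgK.
apply: ucsJ; last exact: sgV.
by apply: IHV; [exact: sgR|exact: ux].
Qed.
End Ucs.
End Normal.

Section UcsTheory.
Context {G : groupType}.
Implicit Types (H K D E S : set G) (x y z g t : G).

Lemma commgMR x h k : [~ x, h * k] = [~ x, k] * [~ x, h] ^ k.
Proof. by rewrite !commgEl !conjgE !invgM !mulgA !mulgK. Qed.

Lemma commgVR x h : [~ x, h^-1] = ([~ x, h] ^ h^-1)^-1.
Proof. by rewrite !commgEl !conjgE !invgM !invgK !mulgA mulgV mul1g. Qed.

Lemma ucs_mono H H' E E' i x : H' `<=` H -> E `<=` E' -> ucs H E i x -> ucs H' E' i x.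
Proof.
move=> HH EE; elim: i x => [|i IH] x /=; first exact: EE.
by move=> ux h /HH Hh; apply: IH; exact: ux.
Qed.

Lemma ucs_trans H D E i j x : (forall y, E y -> ucs H D j y) -> ucs H E i x ->
  ucs H D (i + j) x.
Proof.
move=> ED; elim: i x => [|i IH] x /=; first exact: ED.
by move=> ux h Hh; apply: IH; exact: ux.
Qed.

Lemma ucs_gens H E S c : is_subgroup H -> is_subgroup E ->
  (forall x y, E x -> H y -> E (x ^ y)) -> S `<=` H -> H `<=` smallest is_subgroup S ->
  (forall s (w : seq G), S s -> (forall u, u \in w -> S u) -> size w = c ->
    E (foldl commg s w)) ->
  forall x, H x -> ucs H E c x.
Proof.
move=> sH sE nE SH HS comE.
have step i x : H x -> (forall s, S s -> ucs H E i [~ x, s]) -> ucs H E i.+1 x.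
  move=> Hx Sx /= h Hh.
  have [uM uV] := ucsMV sH sE nE i.
  suff [] : (H `&` [set h | ucs H E i [~ x, h]]) h by [].
  move/HS: Hh; move: h; apply: gen_sub => [|s Ss /=]; last first.
    by split; [exact: SH|exact: Sx].
  apply: is_subgroup_mk => /=.
  - by split; [exact: sg1|rewrite commg1; exact: ucs_1].
  - move=> h k [Hh uh] [Hk uk]; split; first exact: sgM.
    rewrite commgMR; apply: uM => //; last exact: ucsJ.
    by apply: sgJ => //; exact: sgR.
  - move=> h [Hh uh]; have HV := sgV sH Hh; split=> //.
    rewrite commgVR; apply: uV; last exact: ucsJ.
    by apply: sgJ => //; exact: sgR.
have fH s w : S s -> (forall u, u \in w -> S u) -> H (foldl commg s w).
  move=> Ss; elim/last_ind: w => [|w u IH] Sw; first exact: SH.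
  rewrite -cats1 foldl_cat /=; apply: sgR => //; last first.
    by apply/SH/Sw; rewrite mem_rcons mem_head.
  by apply: IH => v vw; apply: Sw; rewrite mem_rcons inE vw orbT.
have key i s w : (i <= c)%N -> S s -> (forall u, u \in w -> S u) -> size w = (c - i)%N ->
    ucs H E i (foldl commg s w).
  elim: i s w => [|i IH] s w ic Ss Sw sw.
    by apply: comE => //; rewrite sw subn0.
  apply: step; first exact: fH.
  move=> u Su; have := IH s (rcons w u) (ltnW ic) Ss.
  rewrite -cats1 foldl_cat /=; apply.
    by move=> v; rewrite mem_cat inE => /orP[/Sw//|/eqP ->].
  by rewrite size_cat sw addn1 -subSn// subSS.
have [uM uV] := ucsMV sH sE nE c.
move=> x /HS Hx; suff [] : (H `&` [set x | ucs H E c x]) x by [].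
move: x Hx; apply: gen_sub => [|s Ss /=]; last first.
  by split; [exact: SH|apply: (key c s [::]) => //; rewrite /= subnn].
apply: is_subgroup_mk => /=.
- by split; [exact: sg1|exact: ucs_1].
- by move=> x y [Hx ux] [Hy uy]; split; [exact: sgM|exact: uM].
- by move=> x [Hx ux]; split; [exact: sgV|exact: uV].
Qed.

Lemma ball_foldl_commg S k s (w : seq G) : ball S k s -> (forall u, u \in w -> ball S k u) ->
  ball S (k * 4 ^ size w) (foldl commg s w).
Proof.
move=> Ss; elim/last_ind: w => [|w u IH] Sw; first by rewrite muln1.
rewrite -cats1 foldl_cat /= size_cat /=.
have {IH}IH : ball S (k * 4 ^ size w) (foldl commg s w).
  by apply: IH => v vw; apply: Sw; rewrite mem_rcons inE vw orbT.
have Su : ball S k u by apply: Sw; rewrite mem_rcons mem_head.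
rewrite commgEl conjgE.
apply: ball_mono (ballM (ballV IH) (ballM (ballV Su) (ballM IH Su))).
rewrite expnD expn1; have : (0 < 4 ^ size w)%N by rewrite expn_gt0.
by move: (4 ^ size w)%N => q; nia.
Qed.
End UcsTheory.

(** * Abelian sections of a polycyclic group *)

Section AbelianSection.
Context {G : groupType}.
Variables (E D : set G).
Hypotheses (nDE : normal_in D E) (abED : forall x y, E x -> E y -> D [~ x, y]).

Let sE : is_subgroup E. Proof. by case: nDE. Qed.
Let sD : is_subgroup D. Proof. by case: nDE. Qed.

Lemma cg_comm x y : E x -> E y -> cg D (x * y) (y * x).
Proof.
move=> Ex Ey; rewrite /cg invgM.
have -> : y^-1 * x^-1 * (y * x) = [~ y, x] by rewrite commgEl conjgE !mulgA.
exact: abED.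
Qed.

Lemma cg_ACA x y z t : E x -> E y -> E z -> E t ->
  cg D (x * y * (z * t)) (x * z * (y * t)).
Proof.
move=> Ex Ey Ez Et; rewrite -!mulgA.
apply: (cgM nDE); [by do !apply: sgM|exact: cg_refl|].
rewrite !mulgA; apply: (cgM nDE) => //; last exact: cg_refl.
exact: cg_comm.
Qed.

Lemma cg_expgMn x y n : E x -> E y -> cg D ((x * y) ^+ n) (x ^+ n * y ^+ n).
Proof.
move=> Ex Ey; elim: n => [|n IH]; first by rewrite !expg0 mulg1; exact: cg_refl.
rewrite !expgS; apply: (cg_trans (y := x * y * (x ^+ n * y ^+ n))) => //.
  by apply: (cgM nDE) => //; [apply: sgX => //; exact: sgM|exact: cg_refl].
by apply: cg_ACA => //; exact: sgX.
Qed.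

Lemma cg_prodM (I : Type) (r : seq I) (F F' : I -> G) :
  (forall i, E (F i)) -> (forall i, E (F' i)) ->
  cg D (\prod_(i <- r) (F i * F' i)) (\prod_(i <- r) F i * \prod_(i <- r) F' i).
Proof.
move=> EF EF'.
have Ep (F0 : I -> G) s : (forall i, E (F0 i)) -> E (\prod_(i <- s) F0 i).
  move=> EF0; elim: s => [|i s IH]; first by rewrite big_nil; exact: sg1.
  by rewrite big_cons; exact: sgM.
elim: r => [|i r IH]; first by rewrite !big_nil mulg1; exact: cg_refl.
rewrite !big_cons; apply: (cg_trans (y := F i * F' i * (\prod_(i <- r) F i * \prod_(i <- r) F' i))) => //.
  apply: (cgM nDE) => //; last exact: cg_refl.
  by apply: Ep => j; exact: sgM.
by apply: cg_ACA => //; exact: Ep.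
Qed.

Variable s : seq G.
Hypotheses (sEs : forall x, x \in s -> E x) (Egen : E `<=` smallest is_subgroup [set` s]).
Notation r := (size s).

Let mono (v : 'rV[int]_r) : G := \prod_(i < r) expgz (nth 1 s i) (v ord0 i).

Let Esi (i : 'I_r) : E (nth 1 s i). Proof. exact/sEs/mem_nth. Qed.

Let Emono v : E (mono v).
Proof.
rewrite /mono; elim: (index_enum _) => [|i l IH]; first by rewrite big_nil; exact: sg1.
by rewrite big_cons; apply: sgM => //; exact: sgXz.
Qed.

Let monoD u v : cg D (mono (u + v)%R) (mono u * mono v).
Proof.
rewrite /mono; under eq_bigr do rewrite mxE expgzD.
by apply: cg_prodM => i; exact: sgXz.
Qed.

Let mono0 : mono 0%R = 1.
Proof. by rewrite /mono big1// => i _; rewrite mxE. Qed.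

Let monoN u : cg D (mono (- u)%R) (mono u)^-1.
Proof.
have := monoD (- u) u; rewrite addNr mono0 => /(cg_sym sD) u1.
rewrite -[mono (- u)](mulgK (mono u)) -[X in cg D _ X]mul1g.
by apply: (cgM nDE); [exact: sgV|exact: u1|exact: cg_refl].
Qed.

Let monoMn u n : cg D (mono (u *+ n)%R) (mono u ^+ n).
Proof.
elim: n => [|n IH]; first by rewrite mulr0n mono0; exact: cg_refl.
rewrite mulrS expgS; apply: (cg_trans (y := mono u * mono (u *+ n)%R)) => //.
by apply: (cgM nDE) => //; exact: cg_refl.
Qed.

Let mono_surj x : E x -> exists v, cg D (mono v) x.
Proof.
have [_ _ DE _] := nDE.
move=> /Egen Hx; suff [] : (E `&` [set x | exists v, cg D (mono v) x]) x by [].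
move: x Hx; apply: gen_sub => [|x /= xs].
  apply: is_subgroup_mk => /=.
  - by split; [exact: sg1|exists 0%R; rewrite mono0; exact: cg_refl].
  - move=> x y [Ex [u ux]] [Ey [v vy]]; split; first exact: sgM.
    exists (u + v)%R; apply: (cg_trans (y := mono u * mono v)) => //.
    exact: (cgM nDE).
  - move=> x [Ex [u ux]]; split; first exact: sgV.
    exists (- u)%R; apply: (cg_trans (y := (mono u)^-1)) => //.
    exact: (cgV nDE).
split; first exact: sEs.
have xr : (index x s < r)%N by rewrite index_mem.
exists (delta_mx ord0 (Ordinal xr)); rewrite /mono.
rewrite (eq_bigr (fun j => if j == Ordinal xr then nth 1 s j else 1)) => [|j _].
  by rewrite -big_mkcond big_pred1_eq nth_index//; exact: cg_refl.
by rewrite mxE eqxx andTb; case: (j == _).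
Qed.

Lemma section_coords : exists (n : nat) (f : G -> 'rV[int]_n) (m : nat),
  [/\ (0 < m)%N, forall x y, E x -> E y -> f (x * y) = (f x + f y)%R,
    forall x, D x -> f x = 0%R, forall x, E x -> f x = 0%R -> D (x ^+ m) &
    forall w, exists2 x, E x & f x = w].
Proof.
have [_ _ DE _] := nDE.
have /choice[a aP] x : exists v, E x -> cg D (mono v) x.
  by have [/mono_surj[v]|nE] := EM (E x); [exists v|exists 0%R].
pose P v := D (mono v).
have DP u v : cg D (mono u) (mono v) -> P (u - v)%R.
  move=> uv; suff : cg D 1 (mono (u - v)%R) by rewrite /cg invg1 mul1g.
  apply: cg_sym => //; apply: (cg_trans (y := mono u * mono (- v)%R)) => //.
  apply: (cg_trans (y := mono u * (mono v)^-1)) => //.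
    by apply: (cgM nDE) => //; exact: cg_refl.
  rewrite -[1](mulgV (mono v)); apply: (cgM nDE) => //; last exact: cg_refl.
  exact: sgV.
have P0 : P 0%R by rewrite /P mono0; exact: sg1.
have PB u v : P u -> P v -> P (u - v)%R.
  move=> Pu Pv; apply: DP; rewrite /cg; apply: sgM => //; exact: sgV.
have [n [C [m [m0 PC CP Csurj]]]] := int_quotient_coords P0 PB.
exists n, (fun x => a x *m C)%R, m; split=> //.
- move=> x y Ex Ey; apply/eqP; rewrite -mulmxDl -subr_eq0 -mulmxBl; apply/eqP/PC/DP.
  apply: (cg_trans (y := x * y)) => //; first exact: aP (sgM sE Ex Ey).
  apply: cg_sym => //; apply: (cg_trans (y := mono (a x) * mono (a y))) => //.
  by apply: (cgM nDE) => //; exact: aP.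
- move=> x Dx; apply: PC; have /(cg_sym sD) := aP _ (DE _ Dx).
  by move=> /(sgM sD Dx); rewrite mulVKg.
- move=> x Ex /CP; rewrite /P => Dm.
  have : cg D (mono (a x *+ m)%R) (x ^+ m).
    by apply: (cg_trans (y := mono (a x) ^+ m)) => //; apply: (cgX _ nDE) => //; exact: aP.
  by move=> /(sgM sD Dm); rewrite mulVKg.
- move=> w; have [v vC] := Csurj w; exists (mono v) => //.
  rewrite -vC; apply/eqP; rewrite -subr_eq0 -mulmxBl; apply/eqP/PC/DP.
  exact: aP.
Qed.

Lemma fin_index_powers (N : set G) (m : nat) : (0 < m)%N -> normal_in E N -> normal_in D N ->
  fin_index [set h | N h /\ forall x, E x -> exists2 y, E y & cg D (y ^+ m) [~ x, h]] N.
Proof.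
case: m => // m _ nEN nDN; have [_ sN _ nE] := nEN; have [_ _ DE _] := nDE.
have /choice[a aP] x : exists v, E x -> cg D (mono v) x.
  by have [/mono_surj[v]|nEx] := EM (E x); [exists v|exists 0%R].
pose c (z : int) : 'I_m.+1 := inord `|(z %% (Posz m.+1))%Z|.
pose phi h : 'M['I_m.+1]_r := (\matrix_(i, j) c (a (nth 1%g s i ^ h)%g ord0 j))%R.
apply: (@fin_index_finType _ _ phi) => h h' Nh Nh' /matrixP eqh.
have NV : N h'^-1 by exact: sgV.
split; first exact: sgM.
pose Q : set G := [set x | exists2 y, E y & cg D (y ^+ m.+1) [~ x, h * h'^-1]].
have Nhh : N (h * h'^-1) by exact: sgM.
have EJ x y : E x -> N y -> E (x ^ y) by exact: nE.
have ER x : E x -> E [~ x, h * h'^-1] by move=> Ex; rewrite commgEl; apply: sgM => //; [exact: sgV|exact: EJ].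
move=> x /Egen Hx; suff [] : (E `&` Q) x by [].
move: x Hx; apply: gen_sub => [|x /= xs].
  apply: is_subgroup_mk; rewrite /Q /=.
  - split; first exact: sg1.
    by exists 1; [exact: sg1|rewrite comm1g expg1n; exact: cg_refl].
  - move=> x y [Ex [x' Ex' xx']] [Ey [y' Ey' yy']]; split; first exact: sgM.
    exists (x' * y'); first exact: sgM.
    apply: (cg_trans (y := x' ^+ m.+1 * y' ^+ m.+1)) => //; first exact: cg_expgMn.
    apply: (cg_trans (y := [~ x, h * h'^-1] * [~ y, h * h'^-1])) => //.
      by apply: (cgM nDE) => //; exact: sgX.
    rewrite !commgEl conjMg invgM.
    have -> : y^-1 * x^-1 * (x ^ (h * h'^-1) * y ^ (h * h'^-1)) =
       y^-1 * (x^-1 * x ^ (h * h'^-1)) * y ^ (h * h'^-1) by rewrite !mulgA.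
    rewrite mulgA; apply: (cgM nDE); [exact: EJ| |exact: cg_refl].
    by apply: cg_comm; [exact: ER|exact: sgV].
  - move=> x [Ex [x' Ex' xx']]; split; first exact: sgV.
    exists x'^-1; first exact: sgV.
    rewrite expVgn; apply: (cg_trans (y := [~ x, h * h'^-1]^-1)) => //.
      by apply: (cgV nDE) => //; exact: sgX.
    rewrite !commgEl conjVg invgM invgK.
    by apply: cg_comm => //; apply: sgV => //; exact: EJ.
split; first exact: sEs.
have xr : (index x s < r)%N by rewrite index_mem.
set i := Ordinal xr; have xi : nth 1 s i = x by rewrite nth_index.
have Ex : E x by exact: sEs.
have [b bE] : exists b : 'rV[int]_r, (a (x ^ h)%g = a (x ^ h')%g + b *+ m.+1)%R.
  exists (\row_j (((a (x ^ h)%g ord0 j) %/ (Posz m.+1))%Z - ((a (x ^ h')%g ord0 j) %/ (Posz m.+1))%Z))%R.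
  apply/rowP => j; have := eqh i j; rewrite !mxE xi mulmxnE mxE /c.
  move: (a _ _ _) (a _ _ _) => u v.
  have mod_lt w : (`|(w %% (Posz m.+1))%Z| < m.+1)%N.
    have := modz_ge0 w (isT : (Posz m.+1) != 0%R); have := ltz_pmod w (isT : (0 < (Posz m.+1))%R).
    by move: (w %% _)%Z; lia.
  move=> /(congr1 val); rewrite /= !inordK// => uv.
  have {}uv : (u %% (Posz m.+1))%Z = (v %% (Posz m.+1))%Z.
    have := modz_ge0 u (isT : (Posz m.+1) != 0%R); have := modz_ge0 v (isT : (Posz m.+1) != 0%R).
    by move: uv; move: (u %% _)%Z (v %% _)%Z; lia.
  rewrite {1}(divz_eq u (Posz m.+1)) {1}(divz_eq v (Posz m.+1)) uv -mulr_natr natz mulrBl.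
  by lia.
exists (mono b ^ h'^-1); first exact: EJ.
rewrite -conjXg.
have -> : [~ x, h * h'^-1] = ((x ^ h')^-1 * x ^ h) ^ h'^-1.
  by rewrite commgEl conjMg conjVg !conjgM conjgK.
apply: (cgJ nDN) => //.
have Eh : E (x ^ h) by exact: EJ.
have Eh' : E (x ^ h') by exact: EJ.
apply: (cg_trans (y := (mono (a (x ^ h')))^-1 * mono (a (x ^ h)))) => //; last first.
  by apply: (cgM nDE) => //; [apply: (cgV nDE) => //; exact: aP|exact: aP].
rewrite bE -[mono b ^+ _](mulKg (mono (a (x ^ h')))).
apply: (cgM nDE); [by apply: sgM => //; exact: sgX|exact: cg_refl|].
apply: cg_sym => //; apply: (cg_trans (y := mono (a (x ^ h')) * mono (b *+ m.+1)%R)) => //.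
by apply: (cgM nDE) => //; exact: cg_refl.
Qed.
End AbelianSection.

Lemma int_additive_mx (n p : nat) (F : 'rV[int]_n -> 'rV[int]_p) :
  (forall u v, F (u + v) = F u + F v)%R ->
  exists M : 'M[int]_(n, p), forall v, F v = (v *m M)%R.
Proof.
move=> FD; have F0 : F 0%R = 0%R by apply: (addrI (F 0%R)); rewrite -FD !addr0.
have FN u : F (- u)%R = (- F u)%R by apply: (addrI (F u)); rewrite -FD !subrr.
have FZ c u : F (c *: u)%R = (c *: F u)%R.
  elim/int_rect: c => [|k IH|k IH]; first by rewrite !scale0r.
    by rewrite intS !scalerDl !scale1r FD IH.
  by rewrite intS opprD !scalerDl !scaleN1r FD IH FN.
exists (\matrix_i F (delta_mx ord0 i))%R => v.
rewrite {1}(row_sum_delta v) (big_morph F FD F0) mulmx_sum_row.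
by apply: eq_bigr => i _; rewrite FZ rowK.
Qed.

Section LinearAction.
Context {G : groupType}.
Variables (N E D : set G).
Hypotheses (nEN : normal_in E N) (nDN : normal_in D N) (DE : D `<=` E).
Variables (n : nat) (f : G -> 'rV[int]_n) (m0 : nat).
Hypotheses (m0_gt0 : (0 < m0)%N)
  (fM : forall x y, E x -> E y -> f (x * y) = (f x + f y)%R)
  (fD : forall x, D x -> f x = 0%R)
  (f_ker : forall x, E x -> f x = 0%R -> D (x ^+ m0))
  (f_surj : forall w, exists2 x, E x & f x = w).

Let sE : is_subgroup E. Proof. by case: nEN. Qed.
Let sN : is_subgroup N. Proof. by case: nEN. Qed.
Let sD : is_subgroup D. Proof. by case: nDN. Qed.
Let EJ x y : E x -> N y -> E (x ^ y). Proof. by case: nEN => _ _ _; apply. Qed.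

Lemma coord1 : f 1 = 0%R. Proof. exact: fD (sg1 sD). Qed.

Lemma coordV x : E x -> f x^-1 = (- f x)%R.
Proof.
by move=> Ex; apply: (addrI (f x)); rewrite -fM ?mulgV ?coord1 ?subrr//; exact: sgV.
Qed.

Lemma coordX x k : E x -> f (x ^+ k) = (f x *+ k)%R.
Proof.
move=> Ex; elim: k => [|k IH]; first by rewrite expg0 coord1.
by rewrite expgS mulrS fM ?IH//; exact: sgX.
Qed.

Lemma coordJ_eq x y h : E x -> E y -> N h -> f x = f y -> f (x ^ h) = f (y ^ h).
Proof.
move=> Ex Ey Nh fxy; apply/eqP; rewrite -subr_eq0 -coordV; last exact: EJ.
rewrite -conjVg -fM ?conjVg; [|exact: EJ|by apply: sgV => //; exact: EJ].
rewrite -conjVg -conjMg; have Exy : E (x * y^-1) by apply: sgM => //; exact: sgV.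
have : D ((x * y^-1) ^+ m0).
  by apply: f_ker => //; rewrite fM ?coordV// ?fxy ?subrr//; exact: sgV.
case: nDN => _ _ _ nD /nD/(_ Nh)/fD; rewrite conjXg coordX; last exact: EJ.
move/matrixP => z; apply/eqP/matrixP => i j; have := z i j.
by rewrite mulmxnE !mxE => /eqP; rewrite mulrn_eq0 gtn_eqF//= => /eqP.
Qed.

Lemma exists_linear_action : exists rho : G -> 'M[int]_n,
  [/\ forall x h, E x -> N h -> f (x ^ h) = (f x *m rho h)%R, rho 1 = 1%:M%R &
    forall h k, N h -> N k -> rho (h * k) = (rho h *m rho k)%R].
Proof.
have /choice[s sP] w : exists x, E x /\ f x = w by have [x] := f_surj w; exists x.
have /choice[rho rhoP] h : exists M : 'M[int]_n, N h ->
    forall x, E x -> f (x ^ h) = (f x *m M)%R.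
  have [Nh|nNh] := EM (N h); last by exists 0%R.
  have [|M MP] := @int_additive_mx _ _ (fun v => f (s v ^ h)).
    move=> u v; rewrite -fM; [|exact: EJ (sP _).1 _|exact: EJ (sP _).1 _].
    rewrite -conjMg; apply: coordJ_eq => //; first exact: (sP _).1.
      by apply: sgM => //; exact: (sP _).1.
    by rewrite fM ?(sP _).2//; exact: (sP _).1.
  exists M => _ x Ex; rewrite -MP; apply: coordJ_eq => //; first exact: (sP _).1.
  by rewrite (sP _).2.
have ext (A B : 'M[int]_n) : (forall x, E x -> f x *m A = f x *m B)%R -> A = B.
  move=> AB; apply/row_matrixP => i; rewrite !rowE.
  by have [x Ex <-] := f_surj (delta_mx ord0 i); exact: AB.
exists rho; split=> [x h Ex Nh||h k Nh Nk]; first exact: rhoP.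
  by apply: ext => x Ex; rewrite -rhoP ?conjg1 ?mulmx1//; exact: sg1.
apply: ext => x Ex; rewrite -rhoP//; last exact: sgM.
by rewrite conjgM mulmxA -!rhoP//; exact: EJ.
Qed.

Variable rho : G -> 'M[int]_n.
Hypotheses (rhoP : forall x h, E x -> N h -> f (x ^ h) = (f x *m rho h)%R)
  (rho1 : rho 1 = 1%:M%R)
  (rhoM : forall h k, N h -> N k -> rho (h * k) = (rho h *m rho k)%R).

Definition cplx p q (A : 'M[int]_(p, q)) : 'M[algC]_(p, q) := map_mx intr A.

Lemma cplxM p q r (A : 'M_(p, q)) (B : 'M_(q, r)) : cplx (A *m B)%R = (cplx A *m cplx B)%R.
Proof. exact: map_mxM. Qed.

Lemma cplx_eq0 p q (A : 'M_(p, q)) : cplx A = 0%R -> A = 0%R.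
Proof.
move=> /matrixP z; apply/matrixP => i j; have := z i j.
by rewrite !mxE => /eqP; rewrite intr_eq0 => /eqP.
Qed.

Lemma cplx_prod (w : seq G) : (forall u, u \in w -> N u) ->
  cplx (rho (\prod_(u <- w) u)) = (\prod_(u <- w) cplx (rho u))%R.
Proof.
elim: w => [|u w IH] Nw; first by rewrite !big_nil rho1 /cplx map_mx1.
have Nu : N u by apply: Nw; rewrite mem_head.
have {}Nw v : v \in w -> N v by move=> vw; apply: Nw; rewrite inE vw orbT.
by rewrite !big_cons rhoM ?cplxM ?IH//; exact: sg_prod.
Qed.

Lemma span_action (H T : set G) : H `<=` N -> T `<=` H ->
  (forall x, T x -> T x^-1) -> H `<=` smallest is_subgroup T ->
  exists X : seq 'M[algC]_n,
    (forall x, x \in X -> exists w : seq G, [/\ (size w <= n * n)%N,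
       forall u, u \in w -> T u & x = cplx (rho (\prod_(u <- w) u))]) /\
    (forall h, H h -> cplx (rho h) \in <<X>>%VS).
Proof.
move=> HN TH TV HT.
have [X [XP PX]] := span_words (fun A : 'M[algC]_n => exists2 u, T u & A = cplx (rho u)).
exists X; split=> [x /XP[w [sw Tw xE]]|h /HT/gen_word[k]].
  have [w' [sw' Tw' wE]] : exists w' : seq G, [/\ size w' = size w, forall u, u \in w' -> T u &
      w = [seq cplx (rho u) | u <- w']].
    elim: w Tw {sw xE} => [|A w IH] Tw; first by exists nil.
    have [|w' [sw' Tw' ->]] := IH; first by move=> B Bw; apply: Tw; rewrite inE Bw orbT.
    have [|u Tu ->] := Tw A; first by rewrite mem_head.
    exists (u :: w'); split=> //=; first by rewrite size_map.
    by move=> v; rewrite inE => /predU1P[->|/Tw'].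
  exists w'; split=> //; first by rewrite sw'.
  by rewrite xE wE big_map cplx_prod// => u /Tw'/TH/HN.
move=> /(is_word_sym TV)[w [sw Tw ->]]; apply: (PX k).
exists [seq cplx (rho u) | u <- w]; split; first by rewrite size_map sw.
  by move=> A /mapP[u /Tw Tu ->]; exists u.
by rewrite big_map cplx_prod// => u /Tw/TH/HN.
Qed.

Lemma eigenvalue_bound (H T : set G) (c : nat) (t : G) :
  is_subgroup H -> H `<=` N -> fin_index H N -> (forall x, H x -> ucs H E c x) ->
  T `<=` H -> (forall x, T x -> T x^-1) -> H `<=` smallest is_subgroup T -> H t ->
  (forall s (w w' : seq G), T s -> (forall u, u \in w -> T u) -> size w = c ->
    (forall u, u \in w' -> T u) -> (size w' <= n * n)%N ->
    exists e e' : seq bool, [/\ size e = size e', e <> e' &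
      \prod_(b <- e) (t * (foldl commg s w ^ (\prod_(u <- w') u)) ^+ b) =
      \prod_(b <- e') (t * (foldl commg s w ^ (\prod_(u <- w') u)) ^+ b)]) ->
  forall (l : algC) (v : 'cV_n), v != 0%R -> (cplx (rho t) *m v = l *: v)%R -> (`|l| <= 2)%R.
Proof.
move=> sH HN fiH nilH TH TV HT Ht coll l v v0 vl.
rewrite real_leNgt ?realn ?normr_real//; apply/negP => l2.
have Nt : N t by exact: HN.
pose g x : 'M[algC]_1 := (cplx (f x) *m v)%R.
have gM x y : E x -> E y -> g (x * y) = (g x + g y)%R.
  by move=> Ex Ey; rewrite /g fM// /cplx map_mxD mulmxDl.
have gV x : E x -> g x^-1 = (- g x)%R.
  by move=> Ex; rewrite /g coordV// /cplx map_mxN mulNmx.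
have g1 : g 1 = 0%R by rewrite /g coord1 /cplx map_mx0 mul0mx.
have gX x k : E x -> g (x ^+ k) = (g x *+ k)%R.
  move=> Ex; elim: k => [|k IH]; first by rewrite expg0 g1.
  by rewrite expgS mulrS gM ?IH//; exact: sgX.
have gJt x : E x -> g (x ^ t) = (l *: g x)%R.
  by move=> Ex; rewrite /g rhoP// cplxM -mulmxA vl -scalemxAr.
have word a (e : seq bool) : E a -> exists2 z, E z &
    \prod_(b <- e) (t * a ^+ b) = t ^+ size e * z /\ g z = (horner_bits l e *: g a)%R.
  move=> Ea; elim/last_ind: e => [|e b [z Ez [ze gz]]].
    by exists 1; [exact: sg1|rewrite big_nil expg0 mulg1 g1 scale0r].
  have Eab : E (a ^+ b) by exact: sgX.
  exists (z ^ t * a ^+ b); first by apply: sgM => //; exact: EJ.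
  rewrite -cats1 big_cat big_seq1 ze size_cat addn1 expgSr cats1; split.
    by rewrite /= conjgE !mulgA mulgK.
  rewrite gM//; last exact: EJ.
  by rewrite gJt// gz gX// horner_bits_rcons scalerDl scalerA mulrC scaler_nat.
have short s (w w' : seq G) : T s -> (forall u, u \in w -> T u) -> size w = c ->
    (forall u, u \in w' -> T u) -> (size w' <= n * n)%N -> E (foldl commg s w) ->
    g (foldl commg s w ^ (\prod_(u <- w') u)) = 0%R.
  move=> Ts Tw sw Tw' sw' Ea.
  have [e [e' [see' nee']]] := coll s w w' Ts Tw sw Tw' sw'.
  set a := _ ^ _; have {}Ea : E a.
    by apply: EJ => //; apply: sg_prod => // u /Tw'/TH/HN.
  have [z Ez [-> gz]] := word a e Ea; have [z' Ez' [-> gz']] := word a e' Ea.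
  rewrite see' => /mulgI zz'; apply: contra_notP nee' => ga0.
  apply: (@horner_bits_inj l) => //; first exact: ltW.
  apply/eqP; rewrite -subr_eq0; have := gz; rewrite zz' gz' => /eqP.
  rewrite eq_sym -subr_eq0 -scalerBl scaler_eq0 => /orP[//|/eqP].
  by move/ga0.
(* H is nilpotent modulo the normal subgroup M, because M contains the iterated
   commutators of the generators; so g vanishes on E up to factors l - 1. *)
pose M : set G := [set x | [/\ E x, H x & forall h, H h -> g (x ^ h) = 0%R]].
have sM : is_subgroup M.
  apply: is_subgroup_mk; rewrite /M /=.
  - by split; [exact: sg1|exact: sg1|move=> h _; rewrite conj1g].
  - move=> x y [Ex Hx gx] [Ey Hy gy]; split; [exact: sgM|exact: sgM|move=> h Hh].
    by rewrite conjMg gM ?gx ?gy ?addr0//; apply: EJ => //; exact: HN.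
  - move=> x [Ex Hx gx]; split; [exact: sgV|exact: sgV|move=> h Hh].
    by rewrite conjVg gV ?gx ?oppr0//; apply: EJ => //; exact: HN.
have nM x y : M x -> H y -> M (x ^ y).
  move=> [Ex Hx gx] Hy; split; [by apply: EJ => //; exact: HN|exact: sgJ|].
  by move=> h Hh; rewrite -conjgM; apply: gx; exact: sgM.
have foldE (b : G) (w : seq G) (Q : set G) : ucs H Q (size w) b -> (forall u, u \in w -> H u) ->
    Q (foldl commg b w).
  elim: w b => [|u w IH] b //= ub Hw; apply: IH.
    by apply: ub; apply: Hw; rewrite mem_head.
  by move=> u' u'w; apply: Hw; rewrite inE u'w orbT.
have foldH (b : G) (w : seq G) : H b -> (forall u, u \in w -> H u) -> H (foldl commg b w).
  elim: w b => [|u w IH] b //= Hb Hw; apply: IH.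
    by apply: sgR => //; apply: Hw; rewrite mem_head.
  by move=> u' u'w; apply: Hw; rewrite inE u'w orbT.
have [X [XP HX]] := span_action HN TH TV HT.
have nilM : forall x, H x -> ucs H M c x.
  apply: (@ucs_gens _ _ _ T) => // s w Ts Tw sw.
  have Hw u : u \in w -> H u by move/Tw/TH.
  have Ea : E (foldl commg s w) by apply: foldE => //; rewrite sw; exact/nilH/TH.
  split=> //; first by apply: foldH => //; exact: TH.
  move=> h /[dup] Hh /HX.
  rewrite /g rhoP//; last exact: HN.
  rewrite cplxM; move: (cplx (rho h)).
  apply: span_ind => [|d A B A0 B0|A /XP[w' [sw' Tw' ->]]].
  - by rewrite mulmx0 mul0mx.
  - by rewrite mulmxDr mulmxDl -scalemxAr -scalemxAl A0 B0 scaler0 addr0.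
  rewrite -cplxM -rhoP//; first exact: short.
  by apply: sg_prod => // u /Tw'/TH/HN.
have gEH b : E b -> H b -> g b = 0%R.
  move=> Eb Hb.
  have comm k : E (foldl commg b (nseq k t)) /\
      g (foldl commg b (nseq k t)) = ((l - 1) ^+ k *: g b)%R.
    elim: k => [|k [Ek gk]]; first by rewrite expr0 scale1r.
    rewrite -addn1 nseqD foldl_cat /= addn1; set y := foldl _ _ _ in Ek gk *.
    have Eyt : E (y ^ t) by exact: EJ.
    split; first by rewrite commgEl; apply: sgM => //; exact: sgV.
    rewrite commgEl gM//; last exact: sgV.
    by rewrite gV// gJt// gk exprS -[in RHS]scalerA scalerBl scale1r addrC.
  have := nilM b Hb; rewrite -{1}(size_nseq c t) => /foldE[|_ _].
    by move=> u /nseqP[->].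
  move=> /(_ 1 (sg1 sH)); rewrite conjg1 (comm c).2 => /eqP.
  rewrite scaler_eq0 expf_eq0 subr_eq0 => /orP[/andP[_ /eqP l1]|/eqP//].
  by move: l2; rewrite l1 normr1 (ltr_nat _ 2 1).
have gE x : E x -> g x = 0%R.
  move=> Ex; have [_ _ EN _] := nEN.
  have [k k0 Hk] := fin_index_expg sH sN fiH (EN _ Ex).
  have /eqP := gEH _ (sgX k sE Ex) Hk; rewrite gX// -scaler_nat scaler_eq0 pnatr_eq0.
  by rewrite gtn_eqF//= => /eqP.
move/eqP: v0; apply; apply/row_matrixP => i; rewrite rowE row0.
have [x Ex xi] := f_surj (delta_mx ord0 i).
by have := gE x Ex; rewrite /g xi /cplx map_delta_mx.
Qed.

Lemma mxtrace_congr1 (t : G) (m : nat) : (3 * n < m)%N ->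
  (forall x, E x -> exists y, (f x *m rho t - f x = f y *+ m)%R) ->
  (`|\tr (cplx (rho t))| <= 2 *+ n)%R -> (\tr (cplx (rho t)) = n%:R)%R.
Proof.
move=> nm cong le.
have trE : (\tr (cplx (rho t)) = (\tr (rho t))%:~R :> algC)%R.
  by rewrite /mxtrace rmorph_sum; apply: eq_bigr => i _; rewrite mxE.
have [z zE] : exists z : int, (\tr (rho t) - n%:Z = z * m%:Z)%R.
  have /choice[y yP] (i : 'I_n) : exists v : 'rV[int]_n,
      (row i (rho t) - delta_mx ord0 i = v *+ m)%R.
    have [x Ex xi] := f_surj (delta_mx ord0 i).
    by have [y yE] := cong x Ex; exists (f y); rewrite -yE xi rowE.
  exists (\sum_i y i ord0 i)%R.
  have <- : (\sum_(i < n) (1 : int) = n%:Z)%R by rewrite sumr_const card_ord natz.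
  rewrite /mxtrace -sumrB mulr_suml; apply: eq_bigr => i _.
  have /matrixP/(_ ord0 i) := yP i; rewrite mulmxnE !mxE !eqxx => ->.
  by rewrite -mulr_natr natz.
have {}le : (`|\tr (rho t)| <= (2 * n)%:Z)%R.
  rewrite -(ler_int algC) intr_norm -trE; apply: le_trans le _.
  by rewrite -mulr_natr -natrM.
have z0 : z = 0%R by move: le zE nm; clear; case: z => [[|z]|z]; nia.
have {}zE : (\tr (rho t) = n%:Z)%R by apply/eqP; rewrite -subr_eq0 zE z0 mul0r.
by rewrite trE zE.
Qed.

Lemma unipotent_action (H T : set G) : is_subgroup H -> H `<=` N -> T `<=` H ->
  (forall x, T x -> T x^-1) -> H `<=` smallest is_subgroup T ->
  (forall w : seq G, (forall u, u \in w -> T u) -> (size w <= (n * n).+1)%N ->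
    (\tr (cplx (rho (\prod_(u <- w) u)%g)) = n%:R)%R) ->
  exists k, forall x, E x -> ucs H [set x | E x /\ f x = 0%R] k x.
Proof.
move=> sH HN TH TV HT trT.
have [X [XP HX]] := span_action HN TH TV HT.
have rhoMc h k : N h -> N k -> cplx (rho (h * k)) = (cplx (rho h) *m cplx (rho k))%R.
  by move=> Nh Nk; rewrite rhoM// cplxM.
have trTM s y : T s -> y \in <<X>>%VS -> (\tr (cplx (rho s) *m y) = \tr y)%R.
  move=> Ts; move: y; apply: span_ind => [|d A B A0 B0|A /XP[w [sw Tw ->]]].
  - by rewrite mulmx0.
  - by rewrite mulmxDr -scalemxAr !mxtraceD !mxtraceZ A0 B0.
  rewrite -rhoMc; [|exact/HN/TH|by apply: sg_prod => // u /Tw/TH/HN].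
  rewrite [RHS]trT//; last exact: leqW.
  have := trT (s :: w); rewrite big_cons; apply=> // u.
  by rewrite inE => /predU1P[->|/Tw].
have trH h : H h -> (\tr (cplx (rho h)) = n%:R)%R.
  move=> /HT/gen_word[k] /(is_word_sym TV)[w [_ Tw ->]].
  elim: w Tw => [|s w IH] Tw; first by rewrite big_nil rho1 /cplx map_mx1 mxtrace1.
  have Ts : T s by apply: Tw; rewrite mem_head.
  have {}Tw u : u \in w -> T u by move=> uw; apply: Tw; rewrite inE uw orbT.
  have Hw : H (\prod_(u <- w) u) by apply: sg_prod => // u /Tw/TH.
  rewrite big_cons rhoMc; [|exact/HN/TH|exact: HN].
  by rewrite trTM ?IH//; exact: HX.
have [|||k kP] := @unipotent_of_mxtrace _ n (fun A => exists2 h, H h & A = cplx (rho h)).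
- by exists 1; [exact: sg1|rewrite rho1 /cplx map_mx1].
- move=> _ _ [h Hh ->] [h' Hh' ->]; exists (h * h'); first exact: sgM.
  by rewrite rhoMc//; exact: HN.
- by move=> _ [h Hh ->]; exact: trH.
exists k => x Ex; set K := [set x | _].
suff gen j y : E y -> (forall w : seq 'M[algC]_n, size w = j ->
      (forall A, A \in w -> exists2 h, H h & A = cplx (rho h)) ->
      cplx (f y) *m \prod_(A <- w) (A - 1) = 0)%R -> ucs H K j y.
  by apply: gen => // w sw Hw; rewrite kP// mulmx0.
elim: j y => [|j IH] y Ey yw /=.
  by split=> //; apply: cplx_eq0; have := yw [::] erefl; rewrite big_nil mulmx1; apply.
move=> h Hh; have Nh := HN _ Hh; have EyJ : E (y ^ h) by exact: EJ.
apply: IH => [|w sw Hw].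
  by rewrite commgEl; apply: sgM => //; exact: sgV.
have := yw (cplx (rho h) :: w); rewrite /= sw big_cons => <-//; last first.
  by move=> A; rewrite inE => /predU1P[->|/Hw//]; exists h.
rewrite -mulmxE mulmxA; congr (_ *m _)%R.
rewrite commgEl fM ?coordV ?rhoP//; last exact: sgV.
by rewrite mulmxBr mulmx1 -cplxM /cplx map_mxD map_mxN addrC.
Qed.
End LinearAction.

Lemma fin_index_I (G : groupType) (H H' K : set G) : fin_index H K -> fin_index H' K ->
  fin_index (H `&` H') K.
Proof.
move=> [d [phi phiP]] [d' [phi' phiP']].
apply: (@fin_index_finType _ _ (fun x => (phi x, phi' x))) => x y Kx Ky [e e'].
by split; [exact: phiP|exact: phiP'].
Qed.

Definition no_free_semigroup (G : groupType) := forall L : nat, exists S : set G,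
  smallest is_subgroup S = [set: G] /\
  forall t a, ball S L t -> ball S L a -> exists e e' : seq bool,
    [/\ size e = size e', e <> e' &
      \prod_(b <- e) (t * a ^+ b) = \prod_(b <- e') (t * a ^+ b)].

Lemma powers_subgroup (G : groupType) (N E D : set G) (m : nat) :
  normal_in E N -> normal_in D N -> D `<=` E -> (forall x y, E x -> E y -> D [~ x, y]) ->
  is_subgroup [set h | N h /\ forall x, E x -> exists2 y, E y & cg D (y ^+ m) [~ x, h]].
Proof.
move=> nEN nDN DE ab; have [sE sN EN nE] := nEN; have [sD _ DN nD] := nDN.
have nDE : normal_in D E by exact: normal_sub nDN.
have EJ x y : E x -> N y -> E (x ^ y) by exact: nE.
apply: is_subgroup_mk => /=.
- by split=> [|x Ex]; [exact: sg1|exists 1; [exact: sg1|rewrite commg1 expg1n; exact: cg_refl]].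
- move=> h k [Nh hP] [Nk kP]; split; first exact: sgM.
  move=> x Ex; have [y Ey yh] := hP x Ex; have [z Ez zk] := kP x Ex.
  exists (z * y ^ k); first by apply: sgM => //; exact: EJ.
  apply: (cg_trans (y := z ^+ m * (y ^ k) ^+ m)) => //.
    by apply: (cg_expgMn nDE ab) => //; exact: EJ.
  rewrite commgMR; apply: (cgM nDN).
  + by rewrite -conjXg; apply/EN/EJ => //; exact: sgX.
  + exact: zk.
  + by rewrite -conjXg; exact: (cgJ nDN).
- move=> h [Nh hP]; have NV := sgV sN Nh; split=> // x Ex.
  have [y Ey yh] := hP x Ex; exists ((y ^ h^-1)^-1); first by apply: sgV => //; exact: EJ.
  rewrite commgVR expVgn; apply: (cgV nDN).
    by apply: EN; apply: sgX => //; exact: EJ.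
  by rewrite -conjXg; exact: (cgJ nDN).
Qed.

Lemma nilpotent_mod_step (G : groupType) (N E D : set G) :
  polyc N -> fin_index N [set: G] -> normal_in E N -> normal_in D N -> D `<=` E ->
  (forall x y, E x -> E y -> D [~ x, y]) -> no_free_semigroup G ->
  (exists H c, [/\ is_subgroup H, H `<=` N, fin_index H N & forall x, H x -> ucs H E c x]) ->
  exists H c, [/\ is_subgroup H, H `<=` N, fin_index H N & forall x, H x -> ucs H D c x].
Proof.
move=> pN fiN nEN nDN DE ab nfs [H [c [sH HN fiH nilH]]].
have [sE sN EN nE] := nEN; have [sD _ DN nD] := nDN.
have nDE : normal_in D E by exact: normal_sub nDN.
have [s [sEs Es]] := polyc_fg (polyc_sub pN sE EN).
have [n [f [m0 [m0_gt0 fM fD f_ker f_surj]]]] := section_coords nDE ab sEs Es.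
have [rho [rhoP rho1 rhoM]] := exists_linear_action nEN nDN m0_gt0 fM fD f_ker f_surj.
pose m := (m0 * (4 * n).+1)%N.
have m_gt0 : (0 < m)%N by rewrite muln_gt0 m0_gt0.
pose Q := [set h | N h /\ forall x, E x -> exists2 y, E y & cg D (y ^+ m) [~ x, h]].
have fiQ : fin_index Q N := fin_index_powers nDE ab sEs Es m_gt0 nEN nDN.
have sQ : is_subgroup Q := powers_subgroup m nEN nDN DE ab.
pose H' := H `&` Q.
have sH' : is_subgroup H' by exact: is_subgroupI.
have fiH' : fin_index H' N by exact: fin_index_I.
have H'H : H' `<=` H by move=> x [].
have H'N : H' `<=` N by move=> x /H'H/HN.
have [d dP] := schreier sH (fin_index_trans fiH fiN).
have [d' d'P] := schreier sH' (fin_index_trans fiH' fiN).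
pose L := ((n * n).+1 * d' + (n * n * d + (d * 4 ^ c + n * n * d)))%N.
have [S [genS nfS]] := nfs L.
have symI K e : is_subgroup K -> forall x, (K `&` ball S e) x -> (K `&` ball S e) x^-1.
  by move=> sK x [Kx Sx]; split; [exact: sgV|exact: ballV].
have EJ x y : E x -> N y -> E (x ^ y) by exact: nE.
have cong t x : Q t -> E x -> exists2 y, E y & cg D (y ^+ m) [~ x, t] /\
    (f x *m rho t - f x = f y *+ m)%R.
  move=> [Nt tP] Ex; have [y Ey yt] := tP x Ex; exists y => //; split=> //.
  have := fD _ yt; have Exy : E (x ^ t) by exact: EJ.
  have Ext : E [~ x, t] by rewrite commgEl; apply: sgM => //; exact: sgV.
  have Eym : E (y ^+ m) by exact: sgX.
  rewrite fM ?(coordV nEN nDN fM fD)// ?(coordX nEN nDN fM fD)//; last exact: sgV.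
  rewrite commgEl fM ?(coordV nEN nDN fM fD)// ?rhoP//; last exact: sgV.
  by move/eqP; rewrite addrC subr_eq0 addrC => /eqP.
have trH' (w : seq G) : (forall u, u \in w -> (H' `&` ball S d') u) ->
    (size w <= (n * n).+1)%N -> (\tr (cplx (rho (\prod_(u <- w) u)%g)) = n%:R)%R.
  move=> Tw sw; set t := (\prod_(u <- w) u)%g.
  have H't : H' t by apply: sg_prod => // u /Tw[].
  have St : ball S L t.
    apply: ball_mono (ball_prod _); last by move=> u /Tw[_]; exact.
    by apply: leq_trans (leq_addr _ _); rewrite leq_mul2r sw orbT.
  apply: (mxtrace_congr1 f_surj (m := m)).
  - by rewrite /m; nia.
  - by move=> x Ex; have [y _ [_ yE]] := cong t x H't.2 Ex; exists y.
  apply: mxtrace_le => l v.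
  apply: (eigenvalue_bound nEN nDN fM fD f_surj rhoP rho1 rhoM sH HN fiH nilH
    (T := H `&` ball S d)) => //.
  - exact: symI.
  - exact: dP.
  - exact: H'H.
  move=> a w1 w2 [_ Sa] Sw1 sw1 Sw2 sw2; apply: nfS => //.
  rewrite conjgE; apply: ball_mono (leq_addl _ _) _.
  have S2 : ball S (n * n * d) (\prod_(u <- w2) u).
    apply: ball_mono (ball_prod _); last by move=> u /Sw2[_]; exact.
    by rewrite leq_mul2r sw2 orbT.
  apply: ballM; first exact: ballV.
  apply: ballM => //; rewrite -sw1; apply: ball_foldl_commg => // u /Sw1[//].
have H'T : H' `<=` smallest is_subgroup (H' `&` ball S d') by exact: d'P.
have [k kP] := unipotent_action nEN nDN fM fD rhoP rho1 rhoM sH' H'N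
  (T := H' `&` ball S d') (fun x => @proj1 _ _) (symI _ _ sH') H'T trH'.
exists H', (c + (k + 1))%N; split=> // x H'x.
apply: (ucs_trans (E := E)); last first.
  by apply: (ucs_mono (H := H)) (nilH _ _) => //; exact: H'H.
move=> y Ey; apply: (ucs_trans (E := [set x | E x /\ f x = 0%R])); last exact: kP.
move=> z [Ez fz] h H'h /=.
have [u Eu [uz uE]] := cong h z H'h.2 Ez.
have fu : f u = 0%R.
  move: uE; rewrite fz mul0mx subrr => /esym/matrixP E0; apply/matrixP => i j.
  by have := E0 i j; rewrite mulmxnE !mxE => /eqP; rewrite mulrn_eq0 gtn_eqF//= => /eqP.
have Dum : D (u ^+ m) by rewrite /m expgnA; apply: sgX => //; exact: f_ker.
by have := sgM sD Dum uz; rewrite mulVKg.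
Qed.

Lemma virtually_nilpotent (G : groupType) (N : set G) :
  polycyclic N -> fin_index N [set: G] -> no_free_semigroup G ->
  exists H c, [/\ polyc H, fin_index H [set: G] & forall x, H x -> ucs H [set 1] c x].
Proof.
move=> /polycyclic_series[k [D [D0 Dk pN DP]]] fiN nfs.
have sN := polyc_subgroup pN.
suff /(_ k (leqnn k)) [H [c [sH HN fiH nilH]]] : forall j, (j <= k)%N -> exists H c,
    [/\ is_subgroup H, H `<=` N, fin_index H N & forall x, H x -> ucs H (D j) c x].
  exists H, c; split; [exact: polyc_sub pN sH HN|exact: fin_index_trans fiN|].
  by rewrite -Dk.
elim=> [_|j IH jk].
  by exists N, 0%N; split=> //; [exact: fin_index_refl|rewrite D0].
apply: (nilpotent_mod_step pN fiN (DP j).1 (DP j.+1).1) => //; last exact/IH/ltnW.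
- exact: ((DP j).2 jk).1.
- exact: ((DP j).2 jk).2.
Qed.

(** * Polynomial growth *)

Lemma leq_wexp2r (m n e : nat) : (m <= n)%N -> (m ^ e <= n ^ e)%N.
Proof. by case: e => // e le; rewrite leq_exp2r. Qed.

Section PolynomialGrowth.
Context {G : groupType}.
Implicit Types (H K : set G) (x y z g t h : G) (X Y : seq G).

Definition poly_ball_growth K := forall X, (forall x, x \in X -> K x) ->
  exists C d : nat, forall n, exists l : seq G,
    (size l <= C * n.+1 ^ d)%N /\ forall x, ball [set` X] n x -> x \in l.

Lemma poly_ball_growth1 : poly_ball_growth [set 1].
Proof.
move=> X X1; exists 1%N, 0%N => n; exists [:: 1]; split=> // x [m _ [w [_ Xw ->]]].
rewrite inE; apply/eqP/(sg_prod is_subgroup1) => s /Xw[/X1//|/X1] /= sV.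
by rewrite -[s]invgK sV invg1.
Qed.

Lemma ball_words X n x : ball [set` X] n x -> exists w : seq G,
  [/\ (size w <= n)%N, forall s, s \in w -> s \in X ++ [seq y^-1 | y <- X] &
    x = \prod_(s <- w) s].
Proof.
move=> [m mn [w [sw Xw ->]]]; exists w; split=> //; first by rewrite sw.
move=> s /Xw[/= sX|/= sX]; rewrite mem_cat ?sX//.
by apply/orP; right; apply/mapP; exists s^-1; rewrite ?invgK.
Qed.

Notation engel t j h := (iter j (fun x => [~ x, t]) h).

(* [h ^ t^(i+1) = (h ^ t^i) ([h, t] ^ t^i)], and [h, t] has smaller Engel depth. *)
Lemma engel_conj_ball t c h (B : set G) :
  (forall j, (j < c)%N -> B (engel t j h)) -> engel t c h = 1 ->
  forall z : int, ball B ((`|z|).+1 ^ c) (h ^ expgz t z).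
Proof.
elim: c h => [|c IH] h Bh hc z.
  by rewrite /= in hc; rewrite hc conj1g; exact: ball1.
pose u := [~ h, t].
have uball (z' : int) : ball B ((`|z'|).+1 ^ c) (u ^ expgz t z').
  apply: IH => [j jc|]; rewrite /u -iterSr; [exact: Bh|exact: hc].
have ht : h ^ t = h * u by rewrite /u commgEl mulVKg.
have Bh1 : ball B 1 h by exists 1%N => //; apply: is_word1; left; exact: (Bh 0%N).
suff key : forall i : nat, ball B (1 + i * i.+1 ^ c) (h ^ expgz t (Posz i)) /\
    ball B (1 + i * i.+1 ^ c) (h ^ expgz t (- Posz i)%R).
  have le (i : nat) : (1 + i * i.+1 ^ c <= i.+1 ^ c.+1)%N.
    by rewrite expnS mulSn leq_add2r expn_gt0.
  have [->|->] : z = Posz `|z|%N \/ z = (- Posz `|z|%N)%R by lia.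
    by rewrite absz_nat; exact: ball_mono (le _) (key _).1.
  by rewrite abszN absz_nat; exact: ball_mono (le _) (key _).2.
have mono (i : nat) : (i.+1 ^ c <= i.+2 ^ c)%N by apply: leq_wexp2r.
elim=> [|i [IHp IHn]]; first by rewrite oppr0 /= conjg1; split.
split.
  have -> : h ^ expgz t (Posz i.+1) = h ^ expgz t (Posz i) * u ^ expgz t (Posz i).
    rewrite intS expgzD expgz1 conjgM ht conjMg//.
  by apply: ball_mono (ballM IHp (uball _)); rewrite absz_nat -addnA -mulSnr leq_add2l leq_mul2l mono.
have -> : h ^ expgz t (- Posz i.+1)%R =
    h ^ expgz t (- Posz i)%R * (u ^ expgz t (- Posz i.+1)%R)^-1.
  have -> : (- Posz i = 1 + (- Posz i.+1))%R by lia.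
  by rewrite expgzD expgz1 conjgM ht conjMg mulgK.
apply: ball_mono (ballM IHn (ballV (uball _))); rewrite abszN absz_nat.
by rewrite -addnA leq_add2l mulSnr leq_add2r leq_mul2l mono orbT.
Qed.

Lemma poly_ball_growth_ext H K t : normal_in H K -> K t ->
  (forall x, K x -> exists a, cg H (expgz t a) x) ->
  (forall h, H h -> exists c, engel t c h = 1) ->
  poly_ball_growth H -> poly_ball_growth K.
Proof.
move=> [sH sK HK nH] Kt tP eng PH X XK.
pose X' := X ++ [seq y^-1 | y <- X].
have X'K x : x \in X' -> K x.
  rewrite mem_cat => /orP[/XK//|/mapP[y /XK Ky ->]]; exact: sgV.
have /choice[a aP] x : exists a, K x -> H ((expgz t a)^-1 * x).
  by have [/tP[a ax]|nK] := EM (K x); [exists a|exists 0%R].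
pose h x := (expgz t (a x))^-1 * x.
have /choice[c cP] x : exists c, K x -> engel t c (h x) = 1.
  by have [/aP/eng[c cx]|nK] := EM (K x); [exists c|exists 0%N].
pose c0 := (\max_(x <- X') c x)%N.
pose A := (\max_(x <- X') `|a x|)%N.
have c0P x : x \in X' -> engel t c0 (h x) = 1.
  move=> xX; have le : (c x <= c0)%N by rewrite /c0 (big_rem x)//= leq_maxl.
  rewrite -(subnK le) iterD cP; last exact: X'K.
  by elim: (c0 - c x)%N => //= j ->; rewrite comm1g.
have AP x : x \in X' -> (`|a x| <= A)%N by move=> xX; rewrite /A (big_rem x)//= leq_maxl.
pose Y := [seq engel t j (h x) | x <- X', j <- iota 0 c0].
have YH y : y \in Y -> H y.
  case/allpairsPdep=> x [j [xX _ ->]]; elim: j => [|j IH] /=; first exact/aP/X'K.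
  by rewrite commgEl; apply: sgM => //; [exact: sgV|exact: nH].
have [C [d CP]] := PH Y YH.
pose Bn n := (n * (A * n).+1 ^ c0)%N.
exists (2 * A.+1 * (C * (A.+1 ^ c0) ^ d))%N, (1 + c0.+1 * d)%N => n.
have [l [sl lP]] := CP (Bn n).
exists [seq expgz t (Posz i - Posz (A * n))%R * y | i <- iota 0 (2 * (A * n)).+1, y <- l]; split.
  rewrite size_allpairs size_iota.
  apply: leq_trans (leq_mul (leqnn _) sl) _.
  have le1 : ((2 * (A * n)).+1 <= 2 * A.+1 * n.+1)%N by nia.
  have le2 : ((Bn n).+1 <= A.+1 ^ c0 * n.+1 ^ c0.+1)%N.
    have le : ((A * n).+1 ^ c0 <= A.+1 ^ c0 * n.+1 ^ c0)%N.
      by rewrite -expnMn; apply: leq_wexp2r; nia.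
    have : (0 < A.+1 ^ c0 * n.+1 ^ c0)%N by rewrite muln_gt0 !expn_gt0.
    rewrite /Bn expnS mulnCA; move: (_ ^ c0 * _)%N le => q le q0.
    by move: ((A * n).+1 ^ c0)%N le => p le; nia.
  apply: leq_trans (leq_mul le1 (leq_mul (leqnn C) (leq_wexp2r _ le2))) _.
  rewrite expnMn expnD expn1 expnM; set p := ((n.+1 ^ _) ^ d)%N; set q := (_ ^ d)%N.
  by apply: eq_leq; ring.
move=> _ /ball_words[w [sw Xw ->]].
have [z [g [zn gY ->]]] : exists (z : int) g, [/\ (`|z| <= A * size w)%N,
    ball [set` Y] (size w * (A * n).+1 ^ c0) g & \prod_(s <- w) s = expgz t z * g].
  elim: w sw Xw => [|x w IH] sw Xw.
    by exists 0%R, 1; split=> //; [exact: ball1|rewrite big_nil mulg1].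
  have xX : x \in X' by apply: Xw; rewrite mem_head.
  have [||z [g [zn gY gE]]] := IH; first exact: ltnW.
    by move=> s sw'; apply: Xw; rewrite inE sw' orbT.
  have ax := AP x xX.
  exists (a x + z)%R, (h x ^ expgz t z * g); split.
  - by rewrite /= mulnS; lia.
  - rewrite /= mulSn; apply: ballM => //.
    apply: ball_mono (engel_conj_ball (c := c0) _ _ _) => //.
    + by apply: leq_wexp2r; move: zn sw => /=; nia.
    + move=> j jc; apply/allpairsPdep; exists x, j; split=> //.
      by rewrite mem_iota.
    + exact: c0P.
  - rewrite big_cons gE -{1}(mulVKg (expgz t (a x)) x) -/(h x) expgzD conjgE.
    by rewrite !mulgA mulgK.
have zn' : (`|z| <= A * n)%N by nia.
apply/allpairsPdep; exists (`|(z + Posz (A * n))%R|)%N, g; split.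
- by rewrite mem_iota; lia.
- by apply: lP; apply: ball_mono gY; rewrite leq_mul2r sw orbT.
- by congr (expgz t _ * _); lia.
Qed.

Lemma poly_ball_growth_polyc K : polyc K ->
  (forall x t, K x -> K t -> exists c, engel t c x = 1) -> poly_ball_growth K.
Proof.
elim=> {K} [_|H K t pH IH nHK Kt tP engK]; first exact: poly_ball_growth1.
have [_ _ HK _] := nHK; apply: (poly_ball_growth_ext nHK Kt tP).
  by move=> h /HK Kh; exact: engK.
by apply: IH => x y /HK Kx /HK Ky; exact: engK.
Qed.

Lemma ucs_engel H E c x t : H t -> ucs H E c x -> E (engel t c x).
Proof. by move=> Ht; elim: c x => // c IH x /(_ t Ht)/IH; rewrite iterSr. Qed.

Lemma exists_coset_reps H : fin_index H [set: G] -> exists (d : nat) (phi : G -> 'I_d) (r : 'I_d -> G),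
  forall x, H (x * (r (phi x))^-1).
Proof.
move=> [d [phi phiP]]; have /choice[r rP] i : exists r, (exists x, phi x = i) -> phi r = i.
  by have [[x xi]|nx] := EM (exists x, phi x = i); [exists x|exists 1].
by exists d, phi, r => x; apply: phiP => //; rewrite rP//; exists x.
Qed.

Lemma poly_ball_growth_fin_index H : fin_index H [set: G] ->
  poly_ball_growth H -> poly_ball_growth [set: G].
Proof.
move=> /exists_coset_reps[d [phi [r rP]]] PH X _.
pose X' := X ++ [seq y^-1 | y <- X].
pose y i x := r i * x * (r (phi (r i * x)))^-1.
pose y0 := 1 * (r (phi 1))^-1.
pose Y := y0 :: [seq y i x | i <- enum 'I_d, x <- X'].
have YH z : z \in Y -> H z.
  rewrite inE => /predU1P[->|/allpairsP[[i x] [_ _ ->]]]; exact: rP.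
have [C [e CP]] := PH Y YH.
exists (C * 2 ^ e * d)%N, e => n; have [l [sl lP]] := CP n.+1.
exists [seq h * r i | h <- l, i <- enum 'I_d]; split.
  rewrite size_allpairs -cardE card_ord mulnAC leq_mul2r; apply/orP; right.
  apply: leq_trans sl _; rewrite -mulnA leq_mul2l -expnMn; apply/orP; right.
  by apply: leq_wexp2r; lia.
move=> _ /ball_words[w [sw Xw ->]].
suff [h [i [hY ->]]] : exists h i, ball [set` Y] (size w).+1 h /\ \prod_(s <- w) s = h * r i.
  apply/allpairsP; exists (h, i); split=> //=; last by rewrite mem_enum.
  by apply: lP; apply: ball_mono hY.
elim/last_ind: w {sw} Xw => [|w x IH] Xw.
  exists y0, (phi 1); split; last by rewrite big_nil /y0 mulgVK.
  by exists 1%N => //; apply: is_word1; left; rewrite /= mem_head.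
have [|h [i [hY wE]]] := IH; first by move=> s sw; apply: Xw; rewrite mem_rcons inE sw orbT.
exists (h * y i x), (phi (r i * x)); split; last first.
  by rewrite -cats1 big_cat big_seq1 /= wE /y !mulgA mulgVK.
rewrite size_rcons -[X in ball _ X]addn1; apply: ballM => //.
exists 1%N => //; apply: is_word1; left; rewrite /= inE; apply/orP; right.
apply/allpairsP; exists (i, x); split=> //=; first by rewrite mem_enum.
by apply: Xw; rewrite mem_rcons mem_head.
Qed.

Lemma finite_generating_ball S n x : smallest is_subgroup S = [set: G] ->
  (word_length S x <= n)%N <-> ball S n x.
Proof.
move=> genS; have [m mx] : exists m, is_word S m x by apply/gen_word; rewrite genS.
have ex : exists m, `[< is_word S m x >] by exists m; exact/asboolP.
have [k /asboolP kx kmin] := ex_minnP ex.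
have [lx lmin] : is_word S (word_length S x) x /\
    forall m, is_word S m x -> (word_length S x <= m)%N.
  apply: (xgetPex 0%N (P := [set n | is_word S n x /\ forall m, is_word S m x -> (n <= m)%N])).
  by exists k; split=> // j jx; apply: kmin; exact/asboolP.
split=> [le|[j jn jx]]; first by exists (word_length S x).
exact: leq_trans (lmin _ jx) jn.
Qed.

Lemma growth_function_ball S n : smallest is_subgroup S = [set: G] ->
  growth_function S n = #|` fset_set (ball S n)|%fset.
Proof.
move=> genS; rewrite /growth_function; congr (#|` fset_set _|)%fset.
by apply/seteqP; split=> x /=; rewrite finite_generating_ball.
Qed.

Lemma fin_index_generated H (s : seq G) : fin_index H [set: G] ->
  H `<=` smallest is_subgroup [set` s] -> exists2 S : seq G, {subset s <= S} &
    smallest is_subgroup [set` S] = [set: G].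
Proof.
move=> /exists_coset_reps[d [phi [r rP]]] Hs.
pose S := s ++ [seq r i | i <- enum 'I_d]; exists S.
  by move=> x xs; rewrite mem_cat xs.
apply/seteqP; split=> // x _; rewrite -(mulgVK (r (phi x)) x).
have gS := gen_subgroup [set` S].
apply: (sgM gS).
  move: (Hs _ (rP x)); move: (_ * _); apply: (gen_sub gS) => y /= ys.
  by apply: sub_gen => /=; rewrite mem_cat; apply/orP; left.
apply: sub_gen => /=; rewrite mem_cat; apply/orP; right.
by apply/mapP; exists (phi x) => //; rewrite mem_enum.
Qed.
End PolynomialGrowth.

Lemma polycyclic_by_finite_fg (G : groupType) : polycyclic_by_finite G ->
  exists S : seq G, smallest is_subgroup [set` S] = [set: G].
Proof.
move=> [N [[sN _ _ _] /polycyclic_series[_ [_ [_ _ pN _]]] /(finite_index_fin_index sN) fiN]].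
have [s [_ Ns]] := polyc_fg pN.
by have [S _ genS] := fin_index_generated fiN Ns; exists S.
Qed.

Lemma polynomial_growth_of_nilpotent (R : realType) (G : groupType) (S : seq G) (H : set G) (c : nat) :
  smallest is_subgroup [set` S] = [set: G] -> polyc H -> fin_index H [set: G] ->
  (forall x, H x -> ucs H [set 1] c x) -> polynomial_growth R G.
Proof.
move=> genS pH fiH nilH; exists [set` S]; split; first by split.
have PG : poly_ball_growth [set: G].
  apply: (poly_ball_growth_fin_index fiH); apply: poly_ball_growth_polyc => // x t Hx Ht.
  by exists c; exact: ucs_engel (nilH _ Hx).
have [//|C [d CP]] := PG S.
exists (C%:R *: ('X + 1) ^+ d)%R => n; have [l [sl lP]] := CP n.
rewrite growth_function_ball//.
have finB : finite_set (ball [set` S] n).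
  by apply: (sub_finite_set (B := [set` l])) => // x /lP.
have le : (#|` fset_set (ball [set` S] n)|%fset <= C * n.+1 ^ d)%N.
  apply: leq_trans sl; apply: uniq_leq_size; first exact: fset_uniq.
  by move=> x; rewrite in_fset_set// => /set_mem/lP.
rewrite hornerZ horner_exp hornerD hornerX hornerC natr1.
by rewrite -natrX -natrM ler_nat.
Qed.

(** * Exponential growth *)

Lemma fekete (R : realType) (v : nat -> R) (b : R) :
  (forall n, 0 <= v n)%R -> (forall m n, v (m + n)%N <= v m + v n)%R ->
  (forall n, (0 < n)%N -> b <= v n / n%:R)%R ->
  exists2 l, (b <= l)%R & (fun n => v n / n%:R)%R @ \oo --> l.
Proof.
move=> v0 vD vb.
pose A := [set (v n / n%:R)%R | n in [set n | (0 < n)%N]].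
have A1 : A (v 1%N / 1%:R)%R by exists 1%N.
have lbA : lbound A 0%R by move=> _ [n _ <-]; rewrite divr_ge0.
have infA : has_inf A by split; [exists (v 1%N / 1%:R)%R|exists 0%R].
exists (inf A).
  by apply: lb_le_inf; [exists (v 1%N / 1%:R)%R|move=> _ [n /= n0 <-]; exact: vb].
have vM q m : (v (q * m)%N <= q%:R * v m + v 0%N)%R.
  elim: q => [|q IH]; first by rewrite mul0n mul0r add0r.
  by rewrite mulSn -natr1 mulrDl mul1r; apply: le_trans (vD _ _) _; lra.
apply/cvgrPdist_le => e e0.
have e2 : (0 < e / 2)%R by rewrite divr_gt0.
have [_ [m /= m0 <-] mlt] := inf_adherent e2 infA.
pose K := (v 0%N + \sum_(r < m) v r)%R.
have K0 : (0 <= K)%R by rewrite addr_ge0// sumr_ge0.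
have vr r : (r < m)%N -> (v 0%N + v r <= K)%R.
  move=> rm; rewrite /K lerD2l (bigD1 (Ordinal rm))//= lerDl.
  by rewrite sumr_ge0.
have mR : (0 < m%:R :> R)%R by rewrite ltr0n.
near=> n.
have n0 : (0 < n)%N by near: n; exact: nbhs_infty_gt.
have nR : (0 < n%:R :> R)%R by rewrite ltr0n.
have infn : (inf A <= v n / n%:R)%R by apply: ge_inf; [exists 0%R|exists n].
have Kn : (K / n%:R <= e / 2)%R.
  rewrite ler_pdivrMr// mulrC -ler_pdivrMr//.
  by near: n; exact: nbhs_infty_ger.
rewrite ler_distlC; apply/andP; split; first by lra.
have key : (v n <= n%:R * (v m / m%:R) + K)%R.
  rewrite {1}(divn_eq n m); apply: le_trans (vD _ _) _.
  apply: le_trans (lerD (vM _ _) (lexx _)) _.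
  have := vr (n %% m)%N (ltn_pmod _ m0).
  suff : ((n %/ m)%:R * v m <= n%:R * (v m / m%:R))%R by lra.
  rewrite mulrA mulrAC ler_wpM2r// ler_pdivlMr// -natrM ler_nat.
  exact: leq_trunc_div.
have : (v n / n%:R <= v m / m%:R + K / n%:R)%R.
  by rewrite ler_pdivrMr// mulrDl divfK ?gt_eqF// mulrC.
lra.
Unshelve. all: by end_near.
Qed.

Section GrowthRate.
Context {G : groupType}.
Implicit Types (S : set G).

Lemma finite_ball S n : finite_set S -> finite_set (ball S n).
Proof.
move=> /finite_seqP[s ->]; suff [l lP] : exists l : seq G, forall x, ball [set` s] n x -> x \in l.
  by apply: (sub_finite_set (B := [set` l])) => // x /lP.
have {}sP x : ball [set` s] n x -> exists w : seq G, [/\ (size w <= n)%N,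
    forall u, u \in w -> u \in s ++ [seq y^-1 | y <- s] & x = \prod_(u <- w) u].
  exact: ball_words.
suff [l lP] : exists l : seq G, forall w : seq G, (size w <= n)%N ->
    (forall u, u \in w -> u \in s ++ [seq y^-1 | y <- s]) -> \prod_(u <- w) u \in l.
  by exists l => x /sP[w [sw ws ->]]; exact: lP.
elim: n {sP} => [|n [l lP]].
  by exists [:: 1] => -[|//] _ _; rewrite big_nil mem_head.
exists (1 :: [seq x * y | x <- s ++ [seq y^-1 | y <- s], y <- l]) => -[|x w] /= sw ws.
  by rewrite big_nil mem_head.
rewrite inE; apply/orP; right; apply/allpairsP; exists (x, \prod_(u <- w) u).
split=> /=; last by rewrite big_cons.
  by apply: ws; rewrite mem_head.
by apply: lP => // u uw; apply: ws; rewrite inE uw orbT.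
Qed.

Lemma ball_split S m n x : ball S (m + n) x ->
  exists y z, [/\ ball S m y, ball S n z & x = y * z].
Proof.
move=> [k kmn [w [sw Sw ->]]].
exists (\prod_(s <- take m w) s), (\prod_(s <- drop m w) s); split.
- exists (size (take m w)); first by rewrite size_take_min geq_minl.
  by exists (take m w); split=> // s /mem_take/Sw.
- exists (size (drop m w)); first by rewrite size_drop sw leq_subLR.
  by exists (drop m w); split=> // s /mem_drop/Sw.
- by rewrite -big_cat cat_take_drop.
Qed.

Lemma growth_function_leq S n (l : seq G) : finite_set S -> smallest is_subgroup S = [set: G] ->
  (forall x, ball S n x -> x \in l) -> (growth_function S n <= size l)%N.
Proof.
move=> finS genS Sl; rewrite growth_function_ball//.
apply: uniq_leq_size; first exact: fset_uniq.
by move=> x; rewrite in_fset_set; [move/set_mem/Sl|exact: finite_ball].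
Qed.

Lemma growth_function_geq S n (l : seq G) : finite_set S -> smallest is_subgroup S = [set: G] ->
  uniq l -> (forall x, x \in l -> ball S n x) -> (size l <= growth_function S n)%N.
Proof.
move=> finS genS ul lS; rewrite growth_function_ball//.
apply: uniq_leq_size => // x /lS Sx.
by rewrite in_fset_set; [exact/mem_set|exact: finite_ball].
Qed.

Lemma growth_functionD S m n : finite_set S -> smallest is_subgroup S = [set: G] ->
  (growth_function S (m + n) <= growth_function S m * growth_function S n)%N.
Proof.
move=> finS genS.
pose B k : seq G := fset_set (ball S k).
have BP k x : ball S k x -> x \in B k.
  by move=> Sx; rewrite /B in_fset_set; [exact/mem_set|exact: finite_ball].
rewrite ![growth_function _ m]growth_function_ball// ![growth_function _ n]growth_function_ball//.
rewrite -(size_allpairs (fun x y => x * y) (B m) (B n)).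
apply: growth_function_leq => // x /ball_split[y [z [Sy Sz ->]]].
by apply/allpairsP; exists (y, z); split=> //; exact: BP.
Qed.

Lemma growth_function_gt0 S n : finite_set S -> smallest is_subgroup S = [set: G] ->
  (0 < growth_function S n)%N.
Proof.
move=> finS genS; apply: (growth_function_geq (l := [:: 1])) => // x.
by rewrite inE => /eqP ->; exact: ball1.
Qed.

Lemma growth_rate_ge (R : realType) S (M : nat) : finite_set S ->
  smallest is_subgroup S = [set: G] -> (0 < M)%N ->
  (forall n, (2 ^ n <= growth_function S (M * n))%N) ->
  (expR (ln 2 / M%:R) <= growth_rate R S)%R.
Proof.
move=> finS genS M0 gM.
pose v n := ln ((growth_function S n)%:R : R).
have gpos n : (0 < (growth_function S n)%:R :> R)%R.
  by rewrite ltr0n growth_function_gt0.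
have MR : (0 < M%:R :> R)%R by rewrite ltr0n.
have vD m n : (v (m + n)%N <= v m + v n)%R.
  rewrite /v -lnM ?posrE// ler_ln ?posrE ?mulr_gt0//.
  by rewrite -natrM ler_nat growth_functionD.
have v0 n : (0 <= v n)%R by rewrite /v ln_ge0// ler1n growth_function_gt0.
have vMn k n : (v (k * n)%N <= k%:R * v n + v 0%N)%R.
  elim: k => [|k IH]; first by rewrite mul0n mul0r add0r.
  by rewrite mulSn -natr1 mulrDl mul1r; apply: le_trans (vD _ _) _; lra.
have vk k n : (0 < k)%N -> (v (k * n)%N <= k%:R * v n)%R.
  case: k => // k _; elim: k => [|k IH]; first by rewrite mul1n mul1r.
  by rewrite mulSn -natr1 mulrDl mul1r addrC; apply: le_trans (vD _ _) _; lra.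
have [n n0|l bl vl] := @fekete R v (ln 2 / M%:R)%R v0 vD.
- have nR : (0 < n%:R :> R)%R by rewrite ltr0n.
  rewrite ler_pdivrMr// mulrAC ler_pdivlMr// mulrC [leRHS]mulrC.
  apply: le_trans (vk M n M0); rewrite /v mulr_natl -lnXn// ler_ln ?posrE ?exprn_gt0//.
  by rewrite -natrX ler_nat.
suff -> : growth_rate R S = expR l by rewrite ler_expR.
apply: cvg_lim => //.
rewrite (_ : (fun _ => _) = (fun n => expR (v n / n%:R)%R)); last first.
  apply/funext => n; rewrite /powR gt_eqF//.
  by rewrite mulrC.
apply: continuous_cvg => //; exact: continuous_expR.
Qed.

End GrowthRate.

Lemma uniform_exponential_growth_of_free_semigroups (R : realType) (G : groupType) (S0 : seq G) :
  smallest is_subgroup [set` S0] = [set: G] -> ~ no_free_semigroup G ->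
  uniform_exponential_growth R G.
Proof.
move=> genS0 /existsNP[L nfs].
pose M := (2 * L).+1.
have MR : (0 < M%:R :> R)%R by rewrite ltr0n.
apply: lt_le_trans (_ : expR (ln 2 / M%:R) <= _)%R.
  by rewrite expR_gt1 divr_gt0// ln_gt0// ltr1n.
apply: lb_le_inf.
  by exists (growth_rate R [set` S0]), [set` S0] => //; split.
move=> _ [S [finS genS] <-]; apply: growth_rate_ge => // n.
have {nfs}[t [a [St Sa inj]]] : exists t a, [/\ ball S L t, ball S L a &
    forall e e' : seq bool, size e = size e' ->
      \prod_(b <- e) (t * a ^+ b) = \prod_(b <- e') (t * a ^+ b) -> e = e'].
  apply: contrapT => none; apply: nfs; exists S; split=> // t a St Sa.
  apply: contrapT => none'; apply: none; exists t, a; split=> // e e' see' ee'.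
  by apply: contrapT => ne; apply: none'; exists e, e'.
pose l := [seq \prod_(b <- tval e) (t * a ^+ (b : bool)) | e <- enum {: n.-tuple bool}].
have -> : (2 ^ n = size l)%N by rewrite size_map -cardE card_tuple card_bool.
apply: growth_function_geq => //.
  rewrite map_inj_uniq ?enum_uniq// => e e' ee'; apply: val_inj; apply: inj => //.
  by rewrite !size_tuple.
move=> _ /mapP[e _ ->].
have : ball S (size [seq t * a ^+ (b : bool) | b <- tval e] * M) (\prod_(x <- [seq t * a ^+ (b : bool) | b <- tval e]) x).
  apply: ball_prod => _ /mapP[b _ ->].
  apply: (ball_mono (m := (L + L)%N)); first by rewrite /M; lia.
  by apply: ballM => //; case: b => //; exact: ball1.
by rewrite big_map size_map size_tuple mulnC.
Qed.

Theorem theorem4p3 (R : realType) (Gamma : groupType)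
    (hGamma : polycyclic_by_finite Gamma) :
  polynomial_growth R Gamma \/ uniform_exponential_growth R Gamma.
Proof.
have [S genS] := polycyclic_by_finite_fg hGamma.
have [nfs|nfs] := EM (no_free_semigroup Gamma); last first.
  by right; exact: uniform_exponential_growth_of_free_semigroups genS nfs.
left; have [N [[sN _ _ _] pN /(finite_index_fin_index sN) fiN]] := hGamma.
have [H [c [pH fiH nilH]]] := virtually_nilpotent pN fiN nfs.
exact: polynomial_growth_of_nilpotent genS pH fiH nilH.
Qed.
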